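(* Let the correlation kernel $K$ be a Matérn kernel with smoothness $\nu\ge1$, a Rational Quadratic kernel with parameter $\nu>0$, or the Squared Exponential kernel. Then the reference prior $\pi(\theta)$ behaves as follows. 1. When $\theta\to0$: $\pi(\theta)=o(1)$ for Matérn and Squared Exponential kernels, and $\pi(\theta)=O(\theta^{2\nu-1})$ for Rational Quadratic kernels. 2. When $\theta\to+\infty$: $\pi(\theta)=O(\theta^{-1})$.
   Context: Let $r\ge1$, $n\ge1$, $0\le p<n$ be integers and let $\boldsymbol x^{(1)},\dots,\boldsymbol x^{(n)}\in\mathbb R^r$ be distinct fixed points. For $\theta>0$ put $K_\theta(t)=K(t/\theta)$ and let $\boldsymbol\Sigma_\theta$ be the $n\times n$ matrix with $(i,i')$-th element $K_\theta(\|\boldsymbol x^{(i)}-\boldsymbol x^{(i')}\|)$ ($\|\cdot\|$ the Euclidean norm). Kernels ($K(0)=1$ and, for $t>0$): Rational Quadratic with parameter $\nu>0$: $K(t)=(1+t^2)^{-\nu}$; Squared Exponential: $K(t)=e^{-t^2}$; Matérn with smoothness $\nu>0$: $K(t)=\Gamma(\nu)^{-1}2^{1-\nu}(2\sqrt\nu\,t)^\nu\mathcal K_\nu(2\sqrt\nu\,t)$, with $\mathcal K_\nu$ the modified Bessel function of the second kind. For these kernels $\boldsymbol\Sigma_\theta$ is symmetric positive definite. If $p\ge1$, $\boldsymbol H$ is a fixed $n\times p$ matrix of rank $p$ and $\boldsymbol W$ is a fixed $n\times(n-p)$ matrix with $\boldsymbol W^\top\boldsymbol W=\boldsymbol I_{n-p}$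 and $\boldsymbol H^\top\boldsymbol W=\boldsymbol 0$. If $p=0$, $\boldsymbol W$ is a fixed orthogonal $n\times n$ matrix, e.g. $\boldsymbol I_n$. Put $\boldsymbol\Sigma^{\boldsymbol W}_\theta=\boldsymbol W^\top\boldsymbol\Sigma_\theta\boldsymbol W$. The (marginal) reference prior on $\theta$ is, up to a positive multiplicative constant, $$\pi(\theta)=\sqrt{\operatorname{Tr}\Big[\Big\{\big(\tfrac{d}{d\theta}\boldsymbol\Sigma^{\boldsymbol W}_\theta\big)(\boldsymbol\Sigma^{\boldsymbol W}_\theta)^{-1}\Big\}^2\Big]-\frac1{n-p}\Big[\operatorname{Tr}\Big\{\big(\tfrac{d}{d\theta}\boldsymbol\Sigma^{\boldsymbol W}_\theta\big)(\boldsymbol\Sigma^{\boldsymbol W}_\theta)^{-1}\Big\}\Big]^2}.$$ *)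

(* Defs.v *)
From mathcomp Require Import all_boot all_order all_algebra.
From mathcomp Require Import all_classical all_reals all_analysis.

Set Implicit Arguments.
Unset Strict Implicit.
Unset Printing Implicit Defensive.

Import Order.TTheory GRing.Theory Num.Theory.
Import numFieldNormedType.Exports.

Local Open Scope classical_set_scope.
Local Open Scope ring_scope.

(* Needed for the Landau notations [f =O_ +oo g] to typecheck: they expect a
   [filter_on], and the library declares none for [pinfty_nbhs]. *)
Canonical pinfty_nbhs_filter_on (R : realType) : filter_on R :=
  FilterType (pinfty_nbhs R) _.

Section SpecialFunctions.
Variable R : realType.
Implicit Types nu z t : R.

Definition cosh (u : R) : R := (expR u + expR (- u)) / 2.

(* Euler's integral, meaningful for [0 < nu]. *)
Definition Gamma nu : R :=
  \int[@lebesgue_measure R]_(s in `]0, +oo[) (s `^ (nu - 1) * expR (- s)).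

(* Modified Bessel function of the second kind, for real order and [0 < z]:
   K_nu(z) = \int_0^oo e^(- z cosh u) cosh(nu u) du  (DLMF 10.32.9). *)
Definition besselK nu z : R :=
  \int[@lebesgue_measure R]_(u in `[0, +oo[)
    (expR (- (z * cosh u)) * cosh (nu * u)).

End SpecialFunctions.

Section Kernels.
Variable R : realType.
Implicit Types nu t : R.

Definition rational_quadratic nu t : R := (1 + t ^+ 2) `^ (- nu).

Definition squared_exponential t : R := expR (- t ^+ 2).

(* The closed form is singular at 0 (besselK diverges there), where the kernel
   takes its limit value 1. *)
Definition matern nu t : R :=
  if t == 0 then 1
  else (Gamma nu)^-1 * 2 `^ (1 - nu) * (2 * Num.sqrt nu * t) `^ nu
       * besselK nu (2 * Num.sqrt nu * t).

End Kernels.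

Section ReferencePrior.
Variables (R : realType) (r n p : nat).
Implicit Types (K : R -> R) (x : 'I_n -> 'rV[R]_r) (W : 'M[R]_(n, n - p)).
Implicit Types theta : R.

(* The library norm on ['rV_r] is the sup norm, hence this definition. *)
Definition euclidean_norm (v : 'rV[R]_r) : R :=
  Num.sqrt (\sum_(j < r) v ord0 j ^+ 2).

Definition Sigma K x theta : 'M[R]_n :=
  \matrix_(i, i') K (euclidean_norm (x i - x i') / theta).

Definition SigmaW K x W theta : 'M[R]_(n - p) :=
  W^T *m Sigma K x theta *m W.

Definition reference_prior K x W theta : R :=
  let M := derive1 (SigmaW K x W) theta *m invmx (SigmaW K x W theta) in
  Num.sqrt (\tr (M *m M) - (n - p)%:R^-1 * (\tr M) ^+ 2).

End ReferencePrior.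

(* Main.v *)
Require Import Defs.
From mathcomp Require Import all_boot all_order all_algebra.
From mathcomp Require Import all_classical all_reals all_analysis.
From mathcomp Require Import measurable_realfun ring lra.

Set Implicit Arguments.
Unset Strict Implicit.
Unset Printing Implicit Defensive.

Import Order.TTheory GRing.Theory Num.Theory.
Import numFieldNormedType.Exports.

Local Open Scope classical_set_scope.
Local Open Scope ring_scope.

(** Each of the three kernels is a mixture of Gaussian kernels,
    [K t = \int phi u * expR (- (a u * t ^+ 2)) du], with [a > 0] and [phi] the
    density of the logarithm of a Gamma variable. Writing
    [q = a u * |x_i - x_j|^2 / theta^2], the entries of [Sigma theta] are the
    averages of [e^-q], and those of its derivative are [2 / theta] times the
    averages of [q * e^-q].

    In [reference_prior] the square of the trace is subtracted, so only the trace
    of the square has to be bounded from above. If [S] is positive definite and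
    [T] symmetric with [|u T u^T| <= c * u S u^T] for all [u], then in an
    [S]-orthonormal basis [T] becomes a symmetric matrix with entries at most [c],
    and [\tr ((T S^-1)^2) <= (m c)^2] ([trace_sqr_le]). Domination between
    quadratic forms survives the projection by [W], so both halves of the theorem
    come down to dominating the form of [q * e^-q] by the form of [e^-q]
    ([prior_le]).

    When [theta] grows, [Sigma theta] degenerates to the rank one matrix of ones
    and entrywise estimates say nothing. The crucial fact is
    [gauss_weighted_dominated]: for a fixed set of distinct points one constant
    [C] gives
      [| \sum v_i v_j q_ij e^-q_ij | <= C * \sum v_i v_j e^-q_ij]
    for every scale [q_ij = s * |x_i - x_j|^2], [s > 0], and every [v]. Being
    uniform in the scale, it can be integrated against the mixture, which yields
    [reference_prior <= C / theta] for all [theta > 0].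
    To prove it at small scale, factor
    [e^-q = e^(- s |x_i|^2) e^(- s |x_j|^2) e^(2 s <x_i, x_j>)] and expand the
    last exponential. The forms [Q_k] of [<x_i, x_j>^k] are nonnegative, and the
    first [n] of them control [\sum v_i^2], since polynomials of degree [n - 1]
    separate [n] points ([sqnorm_le_gramX_form]). Hence the Taylor polynomial of
    degree [n - 1] absorbs its remainder, and also each weight [k] or
    [s |x_i|^2] that the factor [q] brings in. At large scale the Gaussian form
    is bounded below by a multiple of [\sum v_i^2] by the Schur product theorem,
    while [q * e^-q <= 1].

    When [theta] tends to 0, [Sigma theta] tends to the identity, and
    [q * e^-q <= 2 * e^(-q/2)] bounds the derivative by
    [theta^-1 * K (delta / theta)], where [delta] depends on the smallest distance
    between two points. If [K t = O(t^(-2k))], the prior is [O(theta^(2k-1))]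
    ([prior_le_powR]). The exponent is [k = nu] for the Rational Quadratic kernel.
    For the two others [K] decays faster than every power, and [k = 1] already
    gives [O(theta)]. *)

(** * Real quadratic forms *)

Section QuadraticForms.
Variables (R : realType) (n : nat).
Implicit Types (A B : 'I_n -> 'I_n -> R) (u v w : 'I_n -> R).

(** Families and vectors are plain functions of the indices, so that entrywise
    products of matrices and of vectors need no conversion. *)
Definition bform A u v : R := \sum_i \sum_j u i * v j * A i j.

Definition qform A v : R := bform A v v.

Definition psd A : Prop := forall v, 0 <= qform A v.

Definition sqnorm v : R := \sum_i v i ^+ 2.

Lemma eq_bform A B u v : (forall i j, A i j = B i j) -> bform A u v = bform B u v.
Proof. by move=> AB; apply: eq_bigr => i _; apply: eq_bigr => j _; rewrite AB. Qed.

Lemma eq_qform A B v : (forall i j, A i j = B i j) -> qform A v = qform B v.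
Proof. exact: eq_bform. Qed.

Lemma bformD A B u v :
  bform (fun i j => A i j + B i j) u v = bform A u v + bform B u v.
Proof.
rewrite -big_split; apply: eq_bigr => i _; rewrite -big_split.
by apply: eq_bigr => j _; rewrite mulrDr.
Qed.

Lemma bformZ (c : R) A u v : bform (fun i j => c * A i j) u v = c * bform A u v.
Proof.
rewrite mulr_sumr; apply: eq_bigr => i _; rewrite mulr_sumr.
by apply: eq_bigr => j _; rewrite mulrCA.
Qed.

Lemma bform_sum (I : Type) (s : seq I) (A : I -> 'I_n -> 'I_n -> R) u v :
  bform (fun i j => \sum_(k <- s) A k i j) u v = \sum_(k <- s) bform (A k) u v.
Proof.
elim: s => [|a s IH].
  rewrite big_nil /bform big1// => i _; rewrite big1// => j _.
  by rewrite big_nil mulr0.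
rewrite big_cons -IH -bformD; apply: eq_bform => i j.
by rewrite big_cons.
Qed.

Lemma bform_scale A u v (f g : 'I_n -> R) :
  bform A (fun i => u i * f i) (fun j => v j * g j) =
  bform (fun i j => f i * g j * A i j) u v.
Proof.
by apply: eq_bigr => i _; apply: eq_bigr => j _; rewrite mulrACA -!mulrA.
Qed.

Lemma qform_scale A v (f : 'I_n -> R) :
  qform A (fun i => v i * f i) = qform (fun i j => f i * f j * A i j) v.
Proof. exact: bform_scale. Qed.

Lemma bform_combine A (a b c d : R) u v w w' :
  bform A (fun i => a * u i + b * v i) (fun i => c * w i + d * w' i) =
  a * c * bform A u w + a * d * bform A u w' +
  b * c * bform A v w + b * d * bform A v w'.
Proof.
rewrite /bform !mulr_sumr -!big_split; apply: eq_bigr => i _ /=.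
by rewrite !mulr_sumr -!big_split; apply: eq_bigr => j _ /=; ring.
Qed.

Lemma bformC A u v : (forall i j, A i j = A j i) -> bform A u v = bform A v u.
Proof.
move=> sA; rewrite /bform exchange_big; apply: eq_bigr => i _.
by apply: eq_bigr => j _; rewrite sA (mulrC (v i)).
Qed.

Lemma qform_line A (s : R) u v : qform A (fun i => u i + s * v i) =
  qform A u + s * bform A u v + s * bform A v u + s ^+ 2 * qform A v.
Proof.
have -> : (fun i => u i + s * v i) = (fun i => 1 * u i + s * v i).
  by apply/funext => i; rewrite mul1r.
by rewrite /qform bform_combine; ring.
Qed.

Lemma qform_add A u v : qform A (fun i => u i + v i) =
  qform A u + bform A u v + bform A v u + qform A v.
Proof.
have := qform_line A 1 u v; under eq_fun do rewrite mul1r.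
by move=> ->; ring.
Qed.

Lemma qform_sub A u v : qform A (fun i => u i - v i) =
  qform A u - bform A u v - bform A v u + qform A v.
Proof.
have := qform_line A (-1) u v; under eq_fun do rewrite mulN1r.
by move=> ->; ring.
Qed.

Lemma qform_parallelogram A u v :
  qform A (fun i => u i + v i) + qform A (fun i => u i - v i) =
  2 * qform A u + 2 * qform A v.
Proof. by rewrite (qform_add A u v) (qform_sub A u v); ring. Qed.

Lemma psd_qformD A u v : psd A ->
  qform A (fun i => u i + v i) <= 2 * qform A u + 2 * qform A v.
Proof. by move=> pA; rewrite -qform_parallelogram lerDl. Qed.

Lemma qformZv A c v : qform A (fun i => c * v i) = c ^+ 2 * qform A v.
Proof.
rewrite /qform -bformZ [LHS](_ : _ = bform A (fun i => v i * c) (fun i => v i * c)).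
  by rewrite bform_scale expr2.
by under eq_fun do rewrite mulrC.
Qed.

(** A Cauchy-Schwarz inequality without square roots: expand the form at [u + v]
    and at [u - v]. *)
Lemma psd_bform_le A u v : psd A -> (forall i j, A i j = A j i) ->
  `|bform A u v| <= qform A u + qform A v.
Proof.
move=> pA sA.
have := pA (fun i => u i + v i); have := pA (fun i => u i - v i).
rewrite (qform_add A u v) (qform_sub A u v) (bformC v u sA).
have := pA u; have := pA v.
by rewrite ler_norml => *; apply/andP; split; lra.
Qed.

Lemma sqnorm_ge0 v : 0 <= sqnorm v.
Proof. by apply: sumr_ge0 => i _; exact: sqr_ge0. Qed.

(** By [2 |v_i v_j| <= v_i^2 + v_j^2] applied to each term. *)
Lemma qform_le_sqnorm A (M : R) v : (forall i j, `|A i j| <= M) ->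
  `|qform A v| <= n%:R * M * sqnorm v.
Proof.
move=> AM.
have H i j : `|v i * v j * A i j| <= M / 2 * v i ^+ 2 + M / 2 * v j ^+ 2.
  rewrite normrM -mulrDr.
  have : `|v i * v j| <= (v i ^+ 2 + v j ^+ 2) / 2.
    rewrite ler_norml.
    have := sqr_ge0 (v i + v j); have := sqr_ge0 (v i - v j).
    by rewrite sqrrB sqrrD => *; apply/andP; split; lra.
  move=> h; apply: le_trans (ler_pM _ _ h (AM i j)) _ => //.
  by lra.
apply: le_trans (ler_norm_sum _ _ _) _.
apply: (@le_trans _ _ (\sum_i \sum_j (M / 2 * v i ^+ 2 + M / 2 * v j ^+ 2))).
  apply: ler_sum => i _; apply: le_trans (ler_norm_sum _ _ _) _.
  by apply: ler_sum => j _.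
under eq_bigr do rewrite big_split /= sumr_const card_ord -mulr_sumr.
rewrite big_split /= sumr_const card_ord sumrMnl -mulr_sumr -/(sqnorm v).
by rewrite -[X in X + _]mulr_natl -[X in _ + X]mulr_natl; lra.
Qed.

Lemma qform_diag (d : 'I_n -> R) v :
  qform (fun i j => if i == j then d i else 0) v = \sum_i d i * v i ^+ 2.
Proof.
apply: eq_bigr => i _; rewrite (bigD1 i)//= eqxx big1 ?addr0.
  by rewrite mulrC expr2.
by move=> j ji; rewrite eq_sym (negbTE ji) mulr0.
Qed.

Lemma sqnormE v : sqnorm v = qform (fun i j => (i == j)%:R) v.
Proof.
rewrite -[RHS](@eq_qform (fun i j => if i == j then 1 else 0)).
  by rewrite qform_diag; apply: eq_bigr => i _; rewrite mul1r.
by move=> i j; case: eqP.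
Qed.

Lemma sqnorm_eq0 v : sqnorm v <= 0 -> forall i, v i = 0.
Proof.
move=> v0 i; apply/eqP; rewrite -sqrf_eq0.
have := v0; rewrite le_eqVlt ltNge sqnorm_ge0 orbF psumr_eq0.
  by move=> /allP/(_ i (mem_index_enum i)).
by move=> j _; exact: sqr_ge0.
Qed.

Lemma psd_cvg (A : nat -> 'I_n -> 'I_n -> R) B :
  (forall k, psd (A k)) -> (forall i j, A k i j @[k --> \oo] --> B i j) -> psd B.
Proof.
move=> pA AB v.
have /cvg_lim <- // : qform (A k) v @[k --> \oo] --> qform B v.
  rewrite /qform /bform; apply: cvg_big => //=; first exact: add_continuous.
  move=> i _; apply: cvg_big => //=; first exact: add_continuous.
  by move=> j _; apply: cvgMr; exact: AB.
apply: limr_ge; last by apply: nearW => k; exact: pA.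
apply/cvg_ex; exists (qform B v).
rewrite /qform /bform; apply: cvg_big => //=; first exact: add_continuous.
move=> i _; apply: cvg_big => //=; first exact: add_continuous.
by move=> j _; apply: cvgMr; exact: AB.
Qed.

End QuadraticForms.

(** * Quadratic forms in the entrywise powers of a Gram matrix *)

Section GramPowers.
Variables (R : realType) (r n : nat) (X : 'I_n -> 'I_r -> R).
Implicit Types (A : 'I_n -> 'I_n -> R) (v : 'I_n -> R).

Definition gram (i j : 'I_n) : R := \sum_l X i l * X j l.

Lemma gramC i j : gram i j = gram j i.
Proof. by apply: eq_bigr => l _; rewrite mulrC. Qed.

Lemma qform_gram A v :
  qform (fun i j => A i j * gram i j) v =
  \sum_l qform A (fun i => v i * X i l).
Proof.
under [RHS]eq_bigr do rewrite qform_scale.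
rewrite /qform -bform_sum; apply: eq_bform => i j.
by rewrite mulr_sumr; apply: eq_bigr => l _; rewrite mulrC.
Qed.

(** The Schur product theorem for a Gram matrix: the form of [A i j * <x_i, x_j>]
    is the sum over the coordinates [l] of the form of [A] at [v_i * x_i l]. *)
Lemma psd_gram A : psd A -> psd (fun i j => A i j * gram i j).
Proof. by move=> pA v; rewrite qform_gram; apply: sumr_ge0. Qed.

Lemma psd_gramX A k : psd A -> psd (fun i j => A i j * gram i j ^+ k).
Proof.
move=> pA; elim: k => [|k IH] v.
  by rewrite (@eq_qform _ _ _ A)// => i j; rewrite mulr1.
rewrite (eq_qform _ (B := fun i j => A i j * gram i j ^+ k * gram i j)).
  exact: (psd_gram IH).
by move=> i j; rewrite exprSr mulrA.
Qed.

Definition gramX_form k v : R := qform (fun i j => gram i j ^+ k) v.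

Lemma gramX_form0 v : gramX_form 0 v = (\sum_i v i) ^+ 2.
Proof.
rewrite /gramX_form /qform /bform expr2 mulr_suml; apply: eq_bigr => i _.
by rewrite mulr_sumr; apply: eq_bigr => j _; rewrite expr0 mulr1.
Qed.

Lemma psd_gramX_form k : psd (fun i j => gram i j ^+ k).
Proof.
move=> v; rewrite (eq_qform _ (B := fun i j => 1 * gram i j ^+ k)).
  apply: (@psd_gramX (fun _ _ => 1)) => w.
  by rewrite -/(gramX_form 0 w) gramX_form0 sqr_ge0.
by move=> i j; rewrite mul1r.
Qed.

Lemma gramX_form_ge0 k v : 0 <= gramX_form k v.
Proof. exact: psd_gramX_form. Qed.

(** The form of degree [k + 1] at [v] is a sum of nonnegative forms of degree [k],
    one for each coordinate. Multiplying a vector by a coordinate function thus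
    costs only one degree. *)
Lemma gramX_form_coord k v l :
  gramX_form k (fun i => v i * X i l) <= gramX_form k.+1 v.
Proof.
rewrite /gramX_form [leRHS](eq_qform _ (B := fun i j => gram i j ^+ k * gram i j)).
  rewrite qform_gram (bigD1 l)//= lerDl sumr_ge0// => l' _.
  exact: gramX_form_ge0.
by move=> i j; rewrite exprSr.
Qed.

(** The value at the point [i] of the polynomial that is the product of the affine
    functions [x l - a], for [(l, a)] in the list. *)
Definition affine_product (L : seq ('I_r * R)) (i : 'I_n) : R :=
  \prod_(la <- L) (X i la.1 - la.2).

(** Multiplying the vector by a polynomial of degree [m] is controlled by the [m + 1]
    next forms: each factor [x l - a] costs one degree by [gramX_form_coord] and the
    constant [a] by [psd_qformD]. *)
Lemma gramX_form_affine_product L : exists2 C : R, 0 <= C & forall k v,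
  gramX_form k (fun i => v i * affine_product L i) <=
  C * \sum_(j < (size L).+1) gramX_form (k + j) v.
Proof.
elim: L => [|[l a] L [C C0 IH]].
  exists 1 => // k v; rewrite big_ord1 addn0 mul1r.
  rewrite (_ : (fun i => _) = v)//.
  by apply/funext => i; rewrite /affine_product big_nil mulr1.
exists (2 * C + 2 * (a ^+ 2 * C)) => [|k v].
  have a2 := sqr_ge0 a; nra.
pose w i := v i * affine_product L i.
have -> : (fun i => v i * affine_product ((l, a) :: L) i) =
          (fun i => w i * X i l + - a * w i).
  by apply/funext => i; rewrite /w /affine_product big_cons/=; ring.
apply: le_trans (psd_qformD _ _ (@psd_gramX_form k)) _.
rewrite qformZv sqrrN.
pose S := \sum_(j < (size L).+2) gramX_form (k + j) v.
have wS : C * \sum_(j < (size L).+1) gramX_form (k + j) v <=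
          C * \sum_(j < (size L).+2) gramX_form (k + j) v.
  by rewrite ler_wpM2l// [leRHS]big_ord_recr/= lerDl gramX_form_ge0.
have wS1 : C * \sum_(j < (size L).+1) gramX_form (k.+1 + j) v <=
           C * \sum_(j < (size L).+2) gramX_form (k + j) v.
  rewrite ler_wpM2l// [leRHS]big_ord_recl/= -[leLHS]add0r lerD ?gramX_form_ge0//.
  by apply: ler_sum => i _; rewrite /bump/= add1n addnS addSn.
rewrite -![qform _ _]/(gramX_form _ _) [leRHS](_ : _ = 2 * (C * S) + 2 * (a ^+ 2 * (C * S)));
  last by rewrite /S; ring.
apply: lerD.
  rewrite ler_wpM2l//; apply: le_trans (gramX_form_coord _ _ _) _.
  exact: le_trans (IH _ _) wS1.
do 2 rewrite ler_wpM2l ?sqr_ge0//.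
exact: le_trans (IH _ _) wS.
Qed.

Hypothesis X_inj : forall i j, (forall l, X i l = X j l) -> i = j.

(** For each [j] in [s] take one factor [x l - x_j l], with [l] a coordinate at
    which [x_i] and [x_j] differ. *)
Lemma affine_product_separates (i : 'I_n) (s : seq 'I_n) : i \notin s ->
  exists2 L, size L = size s & affine_product L i != 0 /\
    forall j, j \in s -> affine_product L j = 0.
Proof.
elim: s => [_|j s IH].
  by exists [::] => //; split=> //; rewrite /affine_product big_nil oner_neq0.
rewrite in_cons negb_or => /andP[ij /IH[L sL [Li Ls]]].
have [l Xl] : exists l, X i l != X j l.
  apply/not_existsP => Xij; case/eqP: ij; apply: X_inj => l.
  by have /negP/negPn/eqP := Xij l.
exists ((l, X j l) :: L); rewrite /= ?sL//; split.
  by rewrite /affine_product big_cons mulf_neq0// subr_eq0.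
move=> k; rewrite in_cons /affine_product big_cons => /predU1P[->|ks] /=.
  by rewrite subrr mul0r.
by move/Ls: ks; rewrite /affine_product => ->; rewrite mulr0.
Qed.

(** A polynomial of degree [n - 1] vanishing at all points but [x_i] isolates the
    entry [v_i] in the form of degree 0, which is the square of a sum. *)
Lemma sqr_le_gramX_form (i : 'I_n) : exists2 C : R, 0 <= C &
  forall v, v i ^+ 2 <= C * \sum_(j < n) gramX_form j v.
Proof.
have iN : i \notin rem i (enum 'I_n) by rewrite mem_rem_uniqF ?enum_uniq.
have [L sL [Li L0]] := affine_product_separates iN.
have {}sL : (size L).+1 = n.
  by rewrite sL size_rem ?mem_enum// size_enum_ord prednK// (leq_ltn_trans _ (ltn_ord i)).
have [C C0 CP] := gramX_form_affine_product L.
exists (C / affine_product L i ^+ 2) => [|v]; first by rewrite divr_ge0 ?sqr_ge0.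
have := CP 0%N v; rewrite sL gramX_form0 (bigD1 i)//= big1 ?addr0; last first.
  move=> j ji; rewrite L0 ?mulr0//.
  by rewrite mem_rem_uniq ?enum_uniq// !inE ji mem_enum.
rewrite exprMn -ler_pdivlMr ?exprn_even_gt0// => /le_trans; apply.
by rewrite mulrAC; under eq_bigr do rewrite add0n.
Qed.

Lemma sqnorm_le_gramX_form : exists2 C : R, 0 <= C &
  forall v, sqnorm v <= C * \sum_(j < n) gramX_form j v.
Proof.
pose C i := sval (cid2 (sqr_le_gramX_form i)).
have CP i : 0 <= C i /\ forall v, v i ^+ 2 <= C i * \sum_(j < n) gramX_form j v.
  by rewrite /C; case: cid2.
exists (\sum_i C i) => [|v]; first by apply: sumr_ge0 => i _; case: (CP i).
by rewrite mulr_suml; apply: ler_sum => i _; case: (CP i).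
Qed.

End GramPowers.

(** * Taylor remainders of the exponential *)

Section ExpTaylor.
Variable R : realType.

Definition expR_rem (n : nat) (y : R) : R :=
  expR y - \sum_(k < n) y ^+ k / k`!%:R.

Lemma is_derive_expR_rem n (y : R) :
  is_derive y (1 : R) (expR_rem n.+1) (expR_rem n y).
Proof.
elim: n => [|n IH].
  rewrite (_ : expR_rem 1 = fun y => expR y - 1).
    by rewrite /expR_rem big_ord0 subr0; apply: is_derive_eq; rewrite subr0.
  by apply/funext => z; rewrite /expR_rem big_ord1 expr0 fact0 divr1.
rewrite (_ : expR_rem n.+2 =
    expR_rem n.+1 - (n.+1`!%:R^-1 \*: ((@id R) ^+ n.+1))).
  apply: is_derive_eq.
  rewrite /expR_rem [in RHS]big_ord_recr/= opprD addrA; congr (_ - _).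
  rewrite /GRing.scale/= mulr1 factS natrM invfM.
  have : n.+1%:R != 0 :> R by rewrite pnatr_eq0.
  have : n`!%:R != 0 :> R by rewrite pnatr_eq0 -lt0n fact_gt0.
  by move=> *; field; apply/andP.
apply/funext => z.
rewrite !fctE /expR_rem [in LHS]big_ord_recr/= opprD addrA.
by rewrite /GRing.scale/= [in RHS]mulrC.
Qed.

(** Induction by the mean value theorem: the derivative of each remainder is the
    previous one, and all but the first vanish at 0. *)
Lemma expR_rem_le n (y : R) : `|y| <= 1 ->
  `|expR_rem n y| <= expR 1 * `|y| ^+ n.
Proof.
elim: n y => [|n IH] y y1.
  rewrite /expR_rem big_ord0 subr0 expr0 mulr1 ger0_norm ?expR_ge0// ler_expR.
  exact: le_trans (ler_norm _) y1.
have rem0 : expR_rem n.+1 0 = 0.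
  rewrite /expR_rem big_ord_recl/= expr0 fact0 divr1 expR0 big1 ?addr0 ?subrr//.
  by move=> i _; rewrite expr0n mul0r.
have cont a b : {within `[a, b], continuous (expR_rem n.+1)}.
  by apply: derivable_within_continuous => z _; case: (is_derive_expR_rem n z).
have [c [c1 ->]] : exists c, `|c| <= `|y| /\ expR_rem n.+1 y = expR_rem n c * y.
  have [y0|y0] := leP 0 y.
    have [c] := MVT_segment y0 (fun x _ => is_derive_expR_rem n x) (cont _ _).
    rewrite in_itv/= rem0 !subr0 => /andP[c0 cy] ->.
    by exists c; split; rewrite // !ger0_norm.
  have [c] := MVT_segment (ltW y0) (fun x _ => is_derive_expR_rem n x) (cont _ _).
  rewrite in_itv/= rem0 !sub0r => /andP[yc c0] E.
  exists c; split; first by rewrite !ler0_norm ?lerN2// ltW.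
  by apply/oppr_inj; rewrite E mulrN.
rewrite normrM exprSr mulrA ler_pM//.
apply: le_trans (IH _ (le_trans c1 y1)) _.
by rewrite ler_wpM2l ?expR_ge0// lerXn2r ?nnegrE.
Qed.

Lemma expR_taylorE n (y : R) :
  expR y = \sum_(k < n) y ^+ k / k`!%:R + expR_rem n y.
Proof. by rewrite addrC subrK. Qed.

Lemma mul_expRN_le1 (q : R) : 0 <= q -> `|q * expR (- q)| <= 1.
Proof.
move=> q0; rewrite ger0_norm; last by rewrite mulr_ge0 ?expR_ge0.
rewrite expRN ler_pdivrMr ?expR_gt0// mul1r.
by apply: le_trans (expR_ge1Dx q); rewrite lerDr.
Qed.

Lemma finite_bound (I : finType) (f : I -> R) :
  exists2 M : R, 1 <= M & forall i, `|f i| <= M.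
Proof.
exists (1 + \sum_i `|f i|) => [|i].
  by rewrite lerDl sumr_ge0.
by rewrite (bigD1 i)//= addrCA lerDl addr_ge0// sumr_ge0.
Qed.

End ExpTaylor.

(** * Exponentials of a Gram matrix at small scale *)

Section SmallScale.
Variables (R : realType) (r n : nat) (X : 'I_n -> 'I_r -> R).
Hypothesis X_inj : forall i j, (forall l, X i l = X j l) -> i = j.
Implicit Types (tau : R) (v : 'I_n -> R).

Local Notation g := (gram X).
Local Notation Q := (gramX_form X).

(** The Taylor polynomial of degree [n - 1] in [tau] of the form of
    [expR (tau * <x_i, x_j>)]. The number [n] of points is the order at which the
    forms [Q k] determine the vector. *)
Definition exp_taylor tau v : R := \sum_(k < n) tau ^+ k / k`!%:R * Q k v.

Lemma exp_taylor_ge tau k v : 0 <= tau -> (k < n)%N ->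
  tau ^+ k * Q k v <= k`!%:R * exp_taylor tau v.
Proof.
move=> t0 kn; have k0 : k`!%:R != 0 :> R by rewrite pnatr_eq0 -lt0n fact_gt0.
rewrite /exp_taylor (bigD1 (Ordinal kn))//= mulrDr mulrA mulrCA divff// mulr1.
rewrite lerDl mulr_ge0// sumr_ge0// => i _.
by rewrite !mulr_ge0 ?invr_ge0 ?exprn_ge0// gramX_form_ge0.
Qed.

Lemma exp_taylor_ge0 tau v : 0 <= tau -> 0 <= exp_taylor tau v.
Proof.
move=> t0; apply: sumr_ge0 => i _.
by rewrite !mulr_ge0 ?invr_ge0 ?exprn_ge0// gramX_form_ge0.
Qed.

(** Each [Q j] with [j < n] has weight at least of order [tau ^+ n.-1] in the Taylor
    polynomial. The extra factor [tau] on the right makes remainders of order [n]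
    negligible. *)
Lemma sqnorm_le_exp_taylor : exists2 C : R, 0 <= C & forall tau v,
  0 <= tau <= 1 -> tau ^+ n * sqnorm v <= C * tau * exp_taylor tau v.
Proof.
have [C C0 CP] := sqnorm_le_gramX_form X_inj.
exists (C * \sum_(j < n) j`!%:R) => [|tau v /andP[t0 t1]].
  by rewrite mulr_ge0// sumr_ge0.
apply: (@le_trans _ _ (tau ^+ n * (C * \sum_(j < n) Q j v))).
  by rewrite ler_wpM2l ?exprn_ge0.
rewrite mulrCA -!mulrA ler_wpM2l// mulr_sumr mulr_suml; apply: ler_sum => j _.
rewrite mulrCA.
apply: (@le_trans _ _ (tau * (tau ^+ j * Q j v))); last first.
  by rewrite ler_wpM2l// exp_taylor_ge.
rewrite mulrA ler_wpM2r ?gramX_form_ge0// -exprS.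
by rewrite ler_wiXn2l// ltn_ord.
Qed.

(** Below degree [n] the left-hand side is a term of the polynomial, up to a
    factorial. From degree [n] on it is of the size of the remainder, and
    [sqnorm_le_exp_taylor] applies. *)
Lemma gramX_form_le_exp_taylor k : exists2 C : R, 0 <= C & forall tau v,
  0 <= tau <= 1 -> tau ^+ k * Q k v <= C * exp_taylor tau v.
Proof.
have [kn|nk] := ltnP k n.
  exists k`!%:R => // tau v /andP[t0 _]; exact: exp_taylor_ge.
have [C C0 CP] := sqnorm_le_exp_taylor.
have [M M1 MP] := finite_bound (fun ij : 'I_n * 'I_n => g ij.1 ij.2 ^+ k).
have M0 : 0 <= M by exact: le_trans M1.
exists (n%:R * M * C) => [|tau v t01]; first by rewrite !mulr_ge0.
have /andP[t0 t1] := t01.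
have QN : Q k v <= n%:R * M * sqnorm v.
  apply: le_trans (ler_norm _) _.
  by apply: qform_le_sqnorm => i j; exact: (MP (i, j)).
apply: (@le_trans _ _ (tau ^+ n * (n%:R * M * sqnorm v))).
  apply: (@le_trans _ _ (tau ^+ k * (n%:R * M * sqnorm v))).
    by rewrite ler_wpM2l ?exprn_ge0.
  by rewrite ler_wpM2r ?mulr_ge0 ?sqnorm_ge0// ler_wiXn2l.
rewrite mulrCA -[leRHS]mulrA ler_wpM2l ?mulr_ge0//.
apply: le_trans (CP _ _ t01) _.
by rewrite -mulrA ler_wpM2l// ler_piMl// exp_taylor_ge0.
Qed.

Lemma qform_expR_gram (a : 'I_n -> 'I_n -> R) tau v :
  qform (fun i j => a i j * expR (tau * g i j)) v =
  \sum_(k < n) tau ^+ k / k`!%:R * qform (fun i j => a i j * g i j ^+ k) v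
  + qform (fun i j => a i j * expR_rem n (tau * g i j)) v.
Proof.
under eq_bigr do rewrite /qform -bformZ.
rewrite /qform -bform_sum -bformD; apply: eq_bform => i j.
rewrite {1}(expR_taylorE n) mulrDr mulr_sumr; congr (_ + _).
by apply: eq_bigr => k _; rewrite exprMn; ring.
Qed.

(** Remainders of order [n], even with bounded weights [a], are [O(tau)] relative to
    the Taylor polynomial. *)
Lemma qform_expR_rem_le : exists2 tau0 : R, 0 < tau0 <= 1 &
  forall M : R, 0 <= M -> exists2 C : R, 0 <= C & forall (a : 'I_n -> 'I_n -> R) tau v,
    (forall i j, `|a i j| <= M) -> 0 <= tau <= tau0 ->
    `|qform (fun i j => a i j * expR_rem n (tau * g i j)) v| <=
    C * tau * exp_taylor tau v.
Proof.
have [m m1 mP] := finite_bound (fun ij : 'I_n * 'I_n => g ij.1 ij.2).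
have m0 : 0 < m by exact: lt_le_trans m1.
exists m^-1 => [|M M0]; first by rewrite invr_gt0 m0 invf_le1.
have [C C0 CP] := sqnorm_le_exp_taylor.
exists (n%:R * (M * (expR 1 * m ^+ n)) * C) => [|a tau v aM /andP[t0 tm]].
  by rewrite !mulr_ge0 ?expR_ge0 ?exprn_ge0// ltW.
have t1 : 0 <= tau <= 1 by rewrite t0 (le_trans tm)// invf_le1.
apply: (@le_trans _ _ (n%:R * (M * (expR 1 * (tau ^+ n * m ^+ n))) * sqnorm v)).
  apply: qform_le_sqnorm => i j; rewrite normrM ler_pM//.
  have tg : `|tau * g i j| <= tau * m.
    by rewrite normrM (ger0_norm t0) ler_wpM2l//; exact: (mP (i, j)).
  have tm1 : tau * m <= 1 by rewrite -ler_pdivlMr// mul1r.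
  apply: le_trans (expR_rem_le n (le_trans tg tm1)) _.
  rewrite ler_wpM2l ?expR_ge0// -exprMn lerXn2r ?nnegrE//.
  by rewrite mulr_ge0// ltW.
rewrite [leLHS](_ : _ = n%:R * (M * (expR 1 * m ^+ n)) * (tau ^+ n * sqnorm v)).
  rewrite -!mulrA ler_wpM2l// ler_wpM2l// ler_wpM2l ?expR_ge0//.
  by rewrite ler_wpM2l ?exprn_ge0 ?(ltW m0)// [leRHS]mulrA; exact: CP.
by ring.
Qed.

Definition exp_gram tau (i j : 'I_n) : R := expR (tau * g i j).

Lemma exp_gramC tau i j : exp_gram tau i j = exp_gram tau j i.
Proof. by rewrite /exp_gram gramC. Qed.

(** For small [tau] the remainder is at most half of the Taylor polynomial. *)
Lemma exp_taylor_le_exp_gram : exists2 tau0 : R, 0 < tau0 <= 1 &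
  forall tau v, 0 <= tau <= tau0 ->
    exp_taylor tau v <= 2 * qform (exp_gram tau) v.
Proof.
have [t0 /andP[t00 t01] t0P] := qform_expR_rem_le.
have [C C0 CP] := t0P 1 ler01.
have C1 : 0 < 2 * (C + 1) by rewrite mulr_gt0// ltr_wpDl.
exists (Num.min t0 (2 * (C + 1))^-1) => [|tau v].
  by rewrite lt_min t00 invr_gt0 C1 ge_min t01.
rewrite le_min => /and3P[ge0 let0 leC].
rewrite (eq_qform _ (B := fun i j => 1 * expR (tau * g i j))); last first.
  by move=> i j; rewrite mul1r.
rewrite qform_expR_gram.
have -> : \sum_(k < n) tau ^+ k / k`!%:R * qform (fun i j => 1 * g i j ^+ k) v =
    exp_taylor tau v.
  apply: eq_bigr => k _; congr (_ * _); apply: eq_qform => i j.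
  by rewrite mul1r.
have := CP (fun _ _ => 1) tau v (fun _ _ => _) _.
rewrite normr1 lexx ge0 let0 => /(_ (fun _ _ => isT) isT).
have : C * tau <= 1 / 2.
  have : tau * (2 * (C + 1)) <= 1 by rewrite -ler_pdivlMr// mul1r.
  by lra.
move=> /(ler_wpM2r (exp_taylor_ge0 v ge0)).
by rewrite ler_norml => h /andP[]; lra.
Qed.

(** The factor [tau * <x_i, x_j>] turns [tau ^+ k * Q k] into
    [tau ^+ k.+1 * Q k.+1], which the Taylor polynomial still controls. *)
Lemma exp_gram_deriv_le : exists2 tau0 : R, 0 < tau0 <= 1 &
  exists2 C : R, 0 <= C & forall tau v, 0 <= tau <= tau0 ->
    `|qform (fun i j => tau * g i j * exp_gram tau i j) v| <=
    C * exp_taylor tau v.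
Proof.
have [t0 /andP[t00 t01] t0P] := qform_expR_rem_le.
have [m m1 mP] := finite_bound (fun ij : 'I_n * 'I_n => g ij.1 ij.2).
have m0 : 0 <= m by exact: le_trans m1.
have [C C0 CP] := t0P m m0.
pose D k := sval (cid2 (gramX_form_le_exp_taylor k)).
have [D0 DP] : (forall k, 0 <= D k) /\ forall k tau v,
  0 <= tau <= 1 -> tau ^+ k * Q k v <= D k * exp_taylor tau v.
  by split=> k; rewrite /D; case: cid2.
exists t0; first by rewrite t00.
exists (\sum_(k < n) D k.+1 + C) => [|tau v /andP[ge0 let0]].
  by rewrite addr_ge0// sumr_ge0.
have t1 : 0 <= tau <= 1 by rewrite ge0 (le_trans let0).
rewrite (eq_qform _ (B := fun i j => (tau * g i j) * expR (tau * g i j)))//.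
rewrite qform_expR_gram mulrDl.
apply: le_trans (ler_normD _ _) _; apply: lerD.
  rewrite mulr_suml; apply: le_trans (ler_norm_sum _ _ _) _.
  apply: ler_sum => k _.
  rewrite (eq_qform _ (B := fun i j => tau * g i j ^+ k.+1)); last first.
    by move=> i j; rewrite exprS mulrA.
  rewrite /qform bformZ -[bform _ _ _]/(Q k.+1 v) ger0_norm; last first.
    by rewrite !mulr_ge0 ?invr_ge0 ?exprn_ge0// gramX_form_ge0.
  apply: le_trans (DP k.+1 tau v t1).
  rewrite exprSr mulrA ler_wpM2r ?gramX_form_ge0//.
  rewrite ler_wpM2r// ler_piMr ?exprn_ge0// invf_le1 ?ltr0n ?fact_gt0//.
  by rewrite ler1n fact_gt0.
apply: le_trans (CP (fun i j => tau * g i j) tau v _ _) _; last 2 first.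
- by rewrite ge0.
- rewrite ler_wpM2r ?exp_taylor_ge0// ler_piMr//; by case/andP: t1.
move=> i j; rewrite normrM ger0_norm// -[leRHS]mul1r ler_pM//.
  by case/andP: t1.
exact: (mP (i, j)).
Qed.

(** The weight [|x_i|^2 = \sum_l (x_i l)^2] acts on one side of the form only. Splitting
    by [psd_bform_le] replaces it by the form at [tau * v_i * (x_i l)^2], which
    has two more degrees and exactly the factor [tau ^+ 2] that they require. *)
Lemma exp_gram_weight_le : exists2 tau0 : R, 0 < tau0 <= 1 &
  exists2 C : R, 0 <= C & forall tau v, 0 <= tau <= tau0 ->
    `|tau * qform (fun i j => g i i * exp_gram tau i j) v| <=
    C * exp_taylor tau v.
Proof.
have [t0 /andP[t00 t01] t0P] := qform_expR_rem_le.
have [m m1 mP] := finite_bound (fun ij : 'I_n * 'I_n => g ij.1 ij.2).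
have m0 : 0 <= m by exact: le_trans m1.
have [C C0 CP] := t0P m m0.
pose D k := sval (cid2 (gramX_form_le_exp_taylor k)).
have [D0 DP] : (forall k, 0 <= D k) /\ forall k tau v,
  0 <= tau <= 1 -> tau ^+ k * Q k v <= D k * exp_taylor tau v.
  by split=> k; rewrite /D; case: cid2.
exists t0; first by rewrite t00.
exists (\sum_(k < n) \sum_(l < r) (D k.+2 + D k) + C) => [|tau v /andP[ge0 let0]].
  by rewrite addr_ge0// sumr_ge0// => k _; rewrite sumr_ge0// => l _; rewrite addr_ge0.
have t1 : 0 <= tau <= 1 by rewrite ge0 (le_trans let0).
have [_ tle1] := andP t1.
rewrite qform_expR_gram mulrDr mulrDl.
apply: le_trans (ler_normD _ _) _; apply: lerD; last first.
  rewrite normrM ger0_norm// -[leRHS]mul1r ler_pM//.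
  apply: le_trans (CP (fun i j => g i i) tau v _ _) _; last 2 first.
  - by rewrite ge0.
  - by rewrite ler_wpM2r ?exp_taylor_ge0// ler_piMr.
  by move=> i j; exact: (mP (i, i)).
rewrite mulr_suml mulr_sumr; apply: le_trans (ler_norm_sum _ _ _) _.
apply: ler_sum => k _.
rewrite (eq_qform _ (B := fun i j => \sum_l X i l ^+ 2 * (1 * g i j ^+ k))); last first.
  by move=> i j; rewrite mul1r -mulr_suml.
rewrite /qform bform_sum mulr_sumr mulr_sumr mulr_suml.
apply: le_trans (ler_norm_sum _ _ _) _; apply: ler_sum => l _.
have gC i j : g i j ^+ k = g j i ^+ k by rewrite gramC.
set b := bform _ v v.
have -> : tau * (tau ^+ k / k`!%:R * b) = tau ^+ k / k`!%:R *
    bform (fun i j => g i j ^+ k) (fun i => tau * (v i * X i l * X i l)) v.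
  rewrite mulrCA; congr (_ * _); rewrite /b -bformZ.
  apply: eq_bigr => i _; apply: eq_bigr => j _; ring.
rewrite normrM.
have Ek : `|tau ^+ k / k`!%:R| <= tau ^+ k.
  rewrite ger0_norm ?mulr_ge0 ?invr_ge0 ?exprn_ge0//.
  rewrite ler_piMr ?exprn_ge0// invf_le1 ?ltr0n ?fact_gt0//.
  by rewrite ler1n fact_gt0.
apply: le_trans (ler_pM _ _ Ek (psd_bform_le _ _ (psd_gramX_form X k) gC)) _ => //.
rewrite qformZv -![qform _ _]/(Q k _) mulrDr mulrDl lerD ?DP//.
apply: le_trans (DP k.+2 tau v t1).
rewrite mulrA -exprD addn2 ler_wpM2l ?exprn_ge0//.
apply: le_trans (gramX_form_coord _ _ _ _) _; exact: gramX_form_coord.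
Qed.

End SmallScale.

(** * The Gaussian kernel at all scales *)

Section Gaussian.
Variables (R : realType) (r n : nat) (X : 'I_n -> 'I_r -> R).
Hypothesis X_inj : forall i j, (forall l, X i l = X j l) -> i = j.
Implicit Types (s : R) (v : 'I_n -> R).

Local Notation g := (gram X).

Definition dist2 (i j : 'I_n) : R := \sum_l (X i l - X j l) ^+ 2.

Lemma dist2E i j : dist2 i j = g i i + g j j - 2 * g i j.
Proof.
rewrite /dist2 /gram mulr_sumr -sumrN -!big_split; apply: eq_bigr => l _ /=.
by ring.
Qed.

Lemma dist2_ge0 i j : 0 <= dist2 i j.
Proof. by apply: sumr_ge0 => l _; exact: sqr_ge0. Qed.

Lemma dist2C i j : dist2 i j = dist2 j i.
Proof. by rewrite !dist2E (gramC X i j); ring. Qed.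

Lemma dist2ii i : dist2 i i = 0.
Proof. by rewrite dist2E; ring. Qed.

Definition gauss s (i j : 'I_n) : R := expR (- (s * dist2 i j)).

Definition gauss_weighted s (i j : 'I_n) : R := s * dist2 i j * gauss s i j.

Let damp s (v : 'I_n -> R) i : R := v i * expR (- (s * g i i)).

(** [|x_i - x_j|^2] is [|x_i|^2 + |x_j|^2 - 2 <x_i, x_j>]; the first two terms are
    absorbed by rescaling the vector. *)
Lemma qform_gauss s v : qform (gauss s) v = qform (exp_gram X (2 * s)) (damp s v).
Proof.
rewrite qform_scale; apply: eq_qform => i j.
rewrite /gauss /exp_gram -!expRD; congr expR.
by rewrite dist2E; ring.
Qed.

Lemma qform_gauss_weighted s v : qform (gauss_weighted s) v =
  2 * s * qform (fun i j => g i i * exp_gram X (2 * s) i j) (damp s v) -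
  qform (fun i j => 2 * s * g i j * exp_gram X (2 * s) i j) (damp s v).
Proof.
set w := damp s v.
have E : qform (fun i j => g j j * exp_gram X (2 * s) i j) w =
         qform (fun i j => g i i * exp_gram X (2 * s) i j) w.
  rewrite /qform /bform exchange_big; apply: eq_bigr => i _.
  apply: eq_bigr => j _.
  by rewrite [in LHS]exp_gramC (mulrC (w j)).
transitivity (s * qform (fun i j => g i i * exp_gram X (2 * s) i j) w +
  s * qform (fun i j => g j j * exp_gram X (2 * s) i j) w +
  (-1) * qform (fun i j => 2 * s * g i j * exp_gram X (2 * s) i j) w).
  rewrite /qform -!bformZ -!bformD /w /damp bform_scale.
  apply: eq_bform => i j; rewrite /gauss_weighted.
  have -> : gauss s i j = expR (- (s * g i i)) * expR (- (s * g j j)) *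
      exp_gram X (2 * s) i j.
    by rewrite /gauss /exp_gram -!expRD; congr expR; rewrite dist2E; ring.
  by rewrite dist2E; ring.
by rewrite E; ring.
Qed.

Lemma sqnorm_damp s : 0 <= s -> exists2 c : R, 0 < c &
  forall v, c * sqnorm v <= sqnorm (damp s v).
Proof.
move=> s0; have [m m1 mP] := finite_bound (fun i : 'I_n => g i i).
exists (expR (- (2 * s * m))); first exact: expR_gt0.
move=> w; rewrite mulr_sumr; apply: ler_sum => i _.
rewrite exprMn mulrC ler_wpM2l ?sqr_ge0// -expRM_natl ler_expR.
by have := mP i; have := ler_norm (g i i) => ? ?; nra.
Qed.

(** A limit of nonnegative combinations of the products of [psd_gramX]. *)
Lemma psd_exp_gram (A : 'I_n -> 'I_n -> R) s : 0 <= s -> psd A ->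
  psd (fun i j => A i j * exp_gram X s i j).
Proof.
move=> s0 pA.
(* The partial sums of the exponential series. *)
pose F k i j := \sum_(0 <= m < k) s ^+ m / m`!%:R * (A i j * g i j ^+ m).
apply: (@psd_cvg _ _ F) => [k v|i j].
  rewrite /qform /F bform_sum; apply: sumr_ge0 => m _.
  rewrite bformZ mulr_ge0 ?mulr_ge0 ?invr_ge0 ?exprn_ge0//.
  exact: (psd_gramX X m pA).
rewrite (_ : F ^~ i ^~ j = (fun k => A i j * series (exp_coeff (s * g i j)) k)).
  apply: cvgMr; exact: is_cvg_series_exp_coeff.
apply/funext => k; rewrite /F /series/= mulr_sumr; apply: eq_bigr => m _.
by rewrite /exp_coeff/= exprMn; ring.
Qed.

Lemma psd_gauss (A : 'I_n -> 'I_n -> R) s : 0 <= s -> psd A ->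
  psd (fun i j => A i j * gauss s i j).
Proof.
move=> s0 pA v; have s20 : 0 <= 2 * s by rewrite mulr_ge0.
have := psd_exp_gram s20 pA (damp s v).
rewrite qform_scale; congr (_ <= _); apply: eq_qform => i j.
rewrite mulrCA; congr (_ * _).
by rewrite /gauss /exp_gram -!expRD; congr expR; rewrite dist2E; ring.
Qed.

(** Schur product: [gauss t] is the entrywise product of [gauss s] with
    [gauss (t - s)], which is positive semidefinite with unit diagonal, and
    multiplying by the latter leaves [c] times the identity unchanged. *)
Lemma gauss_form_mono (c s t : R) v : 0 <= s <= t ->
  (forall w, c * sqnorm w <= qform (gauss s) w) ->
  c * sqnorm v <= qform (gauss t) v.
Proof.
move=> /andP[s0 st] cP.
(* The assumption says that [gauss s] minus [c] times the identity is positive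
   semidefinite. *)
pose A i j : R := gauss s i j + (- c) * (i == j)%:R.
have pA : psd A.
  by move=> w; rewrite /qform bformD bformZ -![bform _ w w]/(qform _ w) -sqnormE mulNr subr_ge0.
have ts : 0 <= t - s by rewrite subr_ge0.
have := psd_gauss ts pA v.
rewrite (eq_qform _ (B := fun i j => gauss t i j + (- c) * (i == j)%:R)).
  by rewrite /qform bformD bformZ -![bform _ v v]/(qform _ v) -sqnormE mulNr subr_ge0.
move=> i j; rewrite /A mulrDl; congr (_ + _).
  by rewrite /gauss -expRD; congr expR; ring.
have [->|_] := eqVneq i j; last by rewrite mulr0 mul0r.
by rewrite /gauss dist2ii mulr0 oppr0 expR0 mulr1.
Qed.

(** The lower bound [sqnorm_le_exp_taylor] on the Taylor polynomial passes to the
    exponential form by [exp_taylor_le_exp_gram]. *)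
Lemma gauss_form_ge_small : exists2 s0 : R, 0 < s0 &
  forall s, 0 < s <= s0 -> exists2 c : R, 0 < c &
  forall v, c * sqnorm v <= qform (gauss s) v.
Proof.
have [t0 /andP[t00 _] t0P] := exp_taylor_le_exp_gram X_inj.
have [C C0 CP] := sqnorm_le_exp_taylor X_inj.
exists (Num.min (t0 / 2) (1 / 2)) => [|s]; first by rewrite lt_min !divr_gt0.
rewrite le_min => /and3P[s0 st s1].
have [c c0 cP] := sqnorm_damp (ltW s0).
pose K := C + 1.
have K0 : 0 < K by rewrite ltr_wpDl.
exists ((2 * s) ^+ n / (2 * K) * c) => [|v].
  by rewrite mulr_gt0// divr_gt0 ?exprn_gt0 ?mulr_gt0.
have t2 : 0 <= 2 * s <= 1 by apply/andP; split; lra.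
have t2' : 0 <= 2 * s <= t0 by apply/andP; split; lra.
apply: (@le_trans _ _ ((2 * s) ^+ n / (2 * K) * sqnorm (damp s v))).
  rewrite -[leLHS]mulrA ler_wpM2l//.
  by rewrite divr_ge0 ?exprn_ge0 ?mulr_ge0// ltW.
rewrite qform_gauss mulrAC ler_pdivrMr ?mulr_gt0//.
apply: le_trans (CP _ _ t2) _.
have T0 := exp_taylor_ge0 X (damp s v) (proj1 (andP t2)).
apply: (@le_trans _ _ (K * exp_taylor X (2 * s) (damp s v))).
  rewrite ler_wpM2r// /K; have /andP[? ?] := t2; nra.
rewrite [leRHS](_ : _ = K * (2 * qform (exp_gram X (2 * s)) (damp s v))).
  by rewrite ler_wpM2l ?(ltW K0)// t0P.
by ring.
Qed.

(** A lower bound at one small scale propagates to all larger ones. *)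
Lemma gauss_form_ge s : 0 < s -> exists2 c : R, 0 < c &
  forall t v, s <= t -> c * sqnorm v <= qform (gauss t) v.
Proof.
move=> s0; have [s1 s10 s1P] := gauss_form_ge_small.
have [c c0 cP] : exists2 c : R, 0 < c &
    forall v, c * sqnorm v <= qform (gauss (Num.min s s1)) v.
  by apply: s1P; rewrite lt_min s0 s10 ge_min lexx orbT.
exists c => // t v st; apply: gauss_form_mono cP.
by rewrite le_min (ltW s0) (ltW s10) ge_min st.
Qed.

Lemma gauss_weighted_le (s : R) i j : 0 <= s -> `|gauss_weighted s i j| <= 1.
Proof. by move=> s0; apply: mul_expRN_le1; rewrite mulr_ge0// dist2_ge0. Qed.

(** Below the scale [s0] both forms are compared with the same Taylor polynomial.
    Above it, [gauss_weighted] has entries at most 1 while [gauss_form_ge] bounds the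
    Gaussian form from below. *)
Lemma gauss_weighted_dominated : exists2 C : R, 0 <= C & forall s v,
  0 < s -> `|qform (gauss_weighted s) v| <= C * qform (gauss s) v.
Proof.
have [t1 /andP[t10 _] t1P] := exp_taylor_le_exp_gram X_inj.
have [t2 /andP[t20 _] [C2 C20 C2P]] := exp_gram_deriv_le X_inj.
have [t3 /andP[t30 _] [C3 C30 C3P]] := exp_gram_weight_le X_inj.
pose s0 := Num.min t1 (Num.min t2 t3) / 2.
have s00 : 0 < s0 by rewrite divr_gt0// !lt_min t10 t20 t30.
have [c c0 cP] := gauss_form_ge s00.
exists (2 * (C3 + C2) + n%:R / c) => [|s v s_gt0].
  by rewrite addr_ge0 ?mulr_ge0 ?addr_ge0 ?invr_ge0// ltW.
have G0 : 0 <= qform (gauss s) v.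
  have [c' c'0 c'P] := gauss_form_ge s_gt0.
  by apply: le_trans (c'P _ _ (lexx s)); rewrite mulr_ge0 ?(ltW c'0)// sqnorm_ge0.
have [ss0|s0s] := leP s s0; last first.
  rewrite mulrDl -[leLHS]add0r lerD//.
    by rewrite mulr_ge0// mulr_ge0// addr_ge0.
  apply: (@le_trans _ _ (n%:R * 1 * sqnorm v)).
    by apply: qform_le_sqnorm => i j; apply: gauss_weighted_le; exact: ltW.
  rewrite mulr1 -mulrA ler_wpM2l// mulrC ler_pdivlMr// mulrC.
  by apply: cP; exact: ltW.
rewrite mulrDl -[leLHS]addr0 lerD//; last first.
  by rewrite mulr_ge0// divr_ge0// ltW.
have : 2 * s <= Num.min t1 (Num.min t2 t3) by rewrite mulrC -ler_pdivlMr.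
rewrite !le_min => /and3P[st1 st2 st3].
have s2 : 0 <= 2 * s by rewrite mulr_ge0// ltW.
have T1 : exp_taylor X (2 * s) (damp s v) <= 2 * qform (gauss s) v.
  by rewrite qform_gauss; apply: t1P; rewrite s2.
rewrite qform_gauss_weighted; apply: le_trans (ler_normB _ _) _.
apply: (@le_trans _ _ ((C3 + C2) * exp_taylor X (2 * s) (damp s v))).
  by rewrite [leRHS]mulrDl lerD//; [apply: C3P|apply: C2P]; rewrite s2.
rewrite [leRHS](_ : _ = (C3 + C2) * (2 * qform (gauss s) v)); last by ring.
by rewrite ler_wpM2l// addr_ge0.
Qed.

End Gaussian.

(** * Mixtures of Gaussian kernels *)

Section Mixture.
Variables (R : realType) (phi a : R -> R).
Local Notation mu := (@lebesgue_measure R).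
Hypothesis phi_gt0 : forall u, 0 < phi u.
Hypothesis a_gt0 : forall u, 0 < a u.
Hypothesis measurable_a : measurable_fun [set: R] a.
Hypothesis integrable_phi : mu.-integrable [set: R] (EFin \o phi).

Lemma integrable_mulphi (f : R -> R) (M : R) :
  measurable_fun [set: R] f -> (forall u, `|f u| <= M) ->
  mu.-integrable [set: R] (EFin \o (fun u => phi u * f u)).
Proof.
move=> mf fM.
have mphi : measurable_fun [set: R] phi.
  by apply/measurable_EFinP; exact: measurable_int integrable_phi.
have : mu.-integrable [set: R] (EFin \o (fun u => M * phi u)).
  by rewrite /comp; under eq_fun do rewrite EFinM; exact: integrableZl.
apply: le_integrable => //.
  by apply/measurable_EFinP; exact: measurable_funM.
move=> u _ /=; rewrite lee_fin !normrM mulrC ler_wpM2r//.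
exact: le_trans (ler_norm _).
Qed.

(** Otherwise the function would vanish almost everywhere, whereas the real line is
    not negligible. *)
Lemma Rintegral_gt0 (f : R -> R) : mu.-integrable [set: R] (EFin \o f) ->
  (forall u, 0 < f u) -> 0 < \int[mu]_u f u.
Proof.
move=> intf f0; rewrite lt_neqAle Rintegral_ge0 ?andbT => [|u _]; last exact: ltW.
apply/eqP => /esym If0.
have mf := measurable_int mu intf.
have /(ae_eq_integral_abs mu measurableT mf) : (\int[mu]_u `|(EFin \o f) u| = 0)%E.
  transitivity (\int[mu]_u (EFin \o f) u)%E.
    by apply: eq_integral => u _ /=; rewrite ger0_norm// ltW.
  rewrite -[LHS]fineK; last exact: integrable_fin_num.
  by congr EFin.
move=> [A [mA A0 fA]].
have : (mu [set: R] <= mu A)%E.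
  apply: le_measure; rewrite ?inE// => u _; apply: fA => /= /(_ Logic.I).
  by move=> [/eqP]; rewrite gt_eqF.
rewrite [X in (_ <= X)%E]A0.
have -> : [set: R] = `]-oo, +oo[%classic by apply/seteqP; split=> x.
by rewrite lebesgue_measure_itv.
Qed.

Lemma qform_Rintegral n (F : R -> 'I_n -> 'I_n -> R) v :
  (forall i j, mu.-integrable [set: R] (EFin \o (fun u => F u i j))) ->
  mu.-integrable [set: R] (EFin \o (fun u => qform (F u) v)) /\
  qform (fun i j => \int[mu]_u F u i j) v = \int[mu]_u qform (F u) v.
Proof.
move=> intF.
have sumE (I : Type) (s : seq I) (h : I -> R -> R) :
    (forall k, mu.-integrable [set: R] (EFin \o h k)) ->
    mu.-integrable [set: R] (EFin \o (fun u => \sum_(k <- s) h k u)) /\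
    \sum_(k <- s) \int[mu]_u h k u = \int[mu]_u \sum_(k <- s) h k u.
  move=> inth; elim: s => [|k s [IH1 IH2]].
    split.
      rewrite (_ : _ \o _ = cst 0%E); first exact: integrable0.
      by apply/funext => u /=; rewrite big_nil.
    under [RHS]eq_Rintegral do rewrite big_nil.
    by rewrite big_nil Rintegral_cst// mul0r.
  split.
    rewrite (_ : _ \o _ =
      ((EFin \o h k) \+ (EFin \o fun u => (\sum_(k <- s) h k u)%R))%E).
      exact: integrableD.
    by apply/funext => u /=; rewrite big_cons EFinD.
  under [RHS]eq_Rintegral do rewrite big_cons.
  by rewrite big_cons IH2 RintegralD.
have intvF i j : mu.-integrable [set: R] (EFin \o (fun u => v i * v j * F u i j)).
  rewrite (_ : _ \o _ = (fun u => (v i * v j)%:E * (F u i j)%:E)%E).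
    exact: integrableZl (intF i j).
  by apply/funext => u /=; rewrite EFinM.
have I1 i := sumE _ (index_enum 'I_n) (fun j u => v i * v j * F u i j) (intvF i).
have [I2 E2] := sumE _ (index_enum 'I_n)
  (fun i u => \sum_j v i * v j * F u i j) (fun i => (I1 i).1).
split; first exact: I2.
rewrite -[RHS]E2; apply: eq_bigr => i _; rewrite -(I1 i).2.
by apply: eq_bigr => j _; rewrite RintegralZl.
Qed.

Definition mixture (f : R -> R) : R := \int[mu]_u (phi u * f u).

Lemma measurable_gauss_density (d : R) :
  measurable_fun [set: R] (fun u => expR (- (a u * d))).
Proof.
apply: measurableT_comp => //; apply: measurable_funN.
exact: measurable_funM.
Qed.

Lemma gauss_density_le1 (d u : R) : 0 <= d -> `|expR (- (a u * d))| <= 1.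
Proof.
move=> d0; rewrite ger0_norm ?expR_ge0// expR_le1 oppr_le0.
by rewrite mulr_ge0// ltW.
Qed.

Lemma integrable_gauss (d : R) : 0 <= d ->
  mu.-integrable [set: R] (EFin \o (fun u => phi u * expR (- (a u * d)))).
Proof.
move=> d0; apply: (@integrable_mulphi _ 1); first exact: measurable_gauss_density.
by move=> u; exact: gauss_density_le1.
Qed.

Lemma integrable_gauss_weighted (d : R) : 0 <= d ->
  mu.-integrable [set: R]
    (EFin \o (fun u => phi u * (a u * d * expR (- (a u * d))))).
Proof.
move=> d0; apply: (@integrable_mulphi _ 1) => [|u].
  apply: measurable_funM; last exact: measurable_gauss_density.
  exact: measurable_funM.
by apply: mul_expRN_le1; rewrite mulr_ge0// ltW.
Qed.

Definition gauss_mix (d : R) : R := mixture (fun u => expR (- (a u * d))).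

Definition gauss_mix_weighted (d : R) : R :=
  mixture (fun u => a u * d * expR (- (a u * d))).

Lemma is_derive_gauss_density (u d theta : R) : 0 < theta ->
  is_derive theta 1 (fun t => phi u * expR (- (a u * (d / t ^+ 2))))
    (2 / theta * (phi u * (a u * (d / theta ^+ 2) *
       expR (- (a u * (d / theta ^+ 2)))))).
Proof.
move=> t0; have tn0 := lt0r_neq0 t0.
have H : is_derive theta 1 (fun t : R => - (a u * d) *: (t ^+ 2)^-1)
    (- (a u * d) *: (- (theta ^+ 2) ^- 2 *: (2 * theta))).
  apply: is_deriveZ; apply: is_deriveV; first by rewrite expf_neq0.
  by apply: is_derive_eq; rewrite /GRing.scale/= mulr1 -mulr2n mulr_natl.
rewrite (_ : (fun t => _) = phi u \*: (expR \o (fun t => - (a u * d) *: (t ^+ 2)^-1))).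
  apply: is_derive_eq; rewrite /GRing.scale/=.
  have -> : - (a u * d) * (theta ^+ 2)^-1 = - (a u * (d / theta ^+ 2)).
    by rewrite mulNr mulrA.
  by move: (expR _) => E; field.
by apply/funext => t; rewrite /GRing.scale/= mulNr !mulrA.
Qed.

(** Differentiation under the integral: since [q * e^-q <= 1], the derivative in [t]
    of the integrand is at most [2 / t * phi u], hence at most
    [4 / theta * phi u] for [t] between [theta / 2] and [2 * theta]. *)
Lemma is_derive_gauss_mix (d theta : R) : 0 <= d -> 0 < theta ->
  is_derive theta 1 (fun t => gauss_mix (d / t ^+ 2))
    (2 / theta * gauss_mix_weighted (d / theta ^+ 2)).
Proof.
move=> d0 t0.
pose f t u := phi u * expR (- (a u * (d / t ^+ 2))).
have dt0 t : 0 <= d / t ^+ 2 by rewrite divr_ge0 ?sqr_ge0.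
have Ia : `](theta / 2), (theta * 2)[%classic theta.
  by rewrite /= in_itv/=; apply/andP; split; lra.
have I0 t : `](theta / 2), (theta * 2)[%classic t -> 0 < t.
  by rewrite /= in_itv/= => /andP[+ _]; apply: lt_trans; rewrite divr_gt0.
have dfE t u : 0 < t -> partial1of2 f t u =
    2 / t * (phi u * (a u * (d / t ^+ 2) * expR (- (a u * (d / t ^+ 2))))).
  move=> tt0; rewrite /partial1of2 derive1E.
  have Hd := is_derive_gauss_density u d tt0; exact: derive_val.
pose G u := 4 / theta * phi u.
have G0 u : 0 <= G u by rewrite mulr_ge0 ?divr_ge0 // ltW.
have intf t : `](theta / 2), (theta * 2)[%classic t ->
    mu.-integrable [set: R] (EFin \o f t).
  by move=> _; apply: integrable_gauss.
have derf t u : `](theta / 2), (theta * 2)[%classic t -> setT u ->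
    derivable (f^~ u) t 1.
  by move=> /I0 tt0 _; case: (is_derive_gauss_density u d tt0).
have intG : mu.-integrable [set: R] (EFin \o G).
  by rewrite /G /comp; under eq_fun do rewrite EFinM; exact: integrableZl.
have Gub t u : `](theta / 2), (theta * 2)[%classic t -> setT u ->
    `|partial1of2 f t u| <= G u.
  move=> It _; have tt0 := I0 _ It; rewrite dfE//.
  have p0 := phi_gt0 u.
  rewrite normrM ger0_norm ?divr_ge0 ?(ltW tt0)// /G ler_pM ?divr_ge0 ?(ltW tt0)//.
    rewrite ler_pdivrMr// mulrAC ler_pdivlMr//.
    by move: It; rewrite /= in_itv/= => /andP[? _]; lra.
  rewrite normrM gtr0_norm// ler_piMr ?(ltW p0)// mul_expRN_le1//.
  by rewrite mulr_ge0// ltW.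
apply: DeriveDef.
  exact: (derivable_under_integral measurableT Ia intf derf G0 intG Gub).
rewrite -derive1E (differentiation_under_integral measurableT Ia intf derf G0 intG Gub).
under eq_Rintegral do rewrite dfE//.
rewrite RintegralZl//.
exact: integrable_gauss_weighted.
Qed.

End Mixture.

(** All that the asymptotics require of a kernel. The mixture is evaluated at squared
    distances, so the decay [e `^ (- k)] means [K t = O(t^(-2k))]. *)
Definition decaying_gauss_mixture (R : realType) (K : R -> R) (k : R) : Prop :=
  exists phi a : R -> R,
    [/\ [/\ forall u, 0 < phi u, forall u, 0 < a u, measurable_fun [set: R] a &
          (@lebesgue_measure R).-integrable [set: R] (EFin \o phi)],
        forall t, 0 <= t -> K t = gauss_mix phi a (t ^+ 2),
        K 0 = 1 &
        exists2 C, 0 <= C & forall e, 0 < e -> gauss_mix phi a e <= C * e `^ (- k)].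

(** * Traces and Loewner domination *)

Section TraceBound.
Variable R : realType.

Definition mxform m (S : 'M[R]_m) (u : 'rV[R]_m) : R := (u *m S *m u^T) ord0 ord0.

Definition posdef m (S : 'M[R]_m) : Prop :=
  forall u : 'rV[R]_m, u != 0 -> 0 < mxform S u.

Lemma mxformE m (S : 'M[R]_m) (u : 'rV[R]_m) :
  mxform S u = qform (fun i j => S i j) (fun i => u ord0 i).
Proof.
rewrite /mxform mxE /qform /bform exchange_big; apply: eq_bigr => j _.
rewrite !mxE mulr_suml; apply: eq_bigr => i _; by rewrite mulrAC.
Qed.

Lemma mxform_mul m k (S : 'M[R]_m) (B : 'M[R]_(k, m)) (u : 'rV[R]_k) :
  mxform (B *m S *m B^T) u = mxform S (u *m B).
Proof. by rewrite /mxform trmx_mul !mulmxA. Qed.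

(** Induction on the size: eliminating the first row and column by the triangular
    matrix [L] leaves the Schur complement [D'], again symmetric and positive
    definite. *)
Lemma cholesky m (S : 'M[R]_m) : S^T = S -> posdef S ->
  exists P : 'M[R]_m, P *m S *m P^T = 1%:M.
Proof.
elim: m S => [|m IH] S sS pS.
  by exists 1%:M; apply/matrixP => -[].
rewrite -[m.+1]/(1 + m)%N in S sS pS *.
pose a := ulsubmx S; pose b := ursubmx S; pose D := drsubmx S.
have bT : dlsubmx S = b^T by rewrite /b trmx_ursub sS.
have ES : S = block_mx a b b^T D by rewrite -bT submxK.
pose a0 := a ord0 ord0.
have aE : a = a0%:M by rewrite [a]mx11_scalar.
have a_gt0 : 0 < a0.
  have := pS (row_mx 1%:M 0).
  rewrite /mxform ES mul_row_block tr_row_mx mul_row_col trmx0 mulmx0 addr0.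
  rewrite !mul1mx mul0mx addr0 trmx1 mulmx1; apply.
  apply/eqP => /matrixP/(_ ord0 (lshift m ord0)).
  by rewrite row_mxEl !mxE eqxx => /eqP; rewrite oner_eq0.
(* One step of Gaussian elimination, with pivot [a0]. *)
pose L : 'M[R]_(1 + m) := block_mx 1%:M 0 (- a0^-1 *: b^T) 1%:M.
pose D' := D - a0^-1 *: (b^T *m b).
have LSL : L *m S *m L^T = block_mx a 0 0 D'.
  rewrite ES /L tr_block_mx !mulmx_block trmx0 !trmx1.
  rewrite !mul1mx !mul0mx !mulmx0 !mulmx1 !addr0.
  have -> : - a0^-1 *: b^T *m a = - b^T.
    rewrite aE mul_mx_scalar scalerA mulrN divff ?gt_eqF//.
    by rewrite scaleN1r.
  have -> : a *m (- a0^-1 *: b^T)^T = - b.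
    rewrite linearZ/= trmxK aE mul_scalar_mx scalerA mulrN divff ?gt_eqF//.
    by rewrite scaleN1r.
  rewrite !addNr mul0mx add0r.
  by congr block_mx; rewrite /D' -scalemxAl scaleNr addrC.
have sD' : D'^T = D'.
  rewrite /D' linearB/= linearZ/= trmx_mul trmxK; congr (_ - _).
  by rewrite /D trmx_drsub sS.
have pD' : posdef D'.
  move=> u u0.
  have := pS (row_mx 0 u *m L).
  rewrite -mxform_mul LSL /mxform mul_row_block tr_row_mx mul_row_col.
  rewrite !(mul0mx, mulmx0, trmx0, add0r) mul_mx_row mul_row_col.
  rewrite !(mul0mx, mulmx0, add0r); apply.
  apply: contraNneq u0; rewrite mulmx1.
  by move/(congr1 rsubmx); rewrite row_mxKr linear0 => ->.
have [P PP] := IH D' sD' pD'.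
exists (block_mx (Num.sqrt a0)^-1%:M 0 0 P *m L).
rewrite trmx_mul !mulmxA -[_ *m L *m S]mulmxA -[_ *m (L *m S) *m L^T]mulmxA LSL.
rewrite tr_block_mx !mulmx_block !trmx0 !(mul0mx, mulmx0, addr0, add0r) PP.
rewrite aE tr_scalar_mx -!scalar_mxM.
have -> : (Num.sqrt a0)^-1 * a0 * (Num.sqrt a0)^-1 = 1.
  rewrite -{2}(sqr_sqrtr (ltW a_gt0)); field.
  by rewrite gt_eqF// sqrtr_gt0.
by rewrite -scalar_mx_block.
Qed.

(** By polarisation and the parallelogram identity for [sqnorm]. *)
Lemma bform_le_sqnorm n (A : 'I_n -> 'I_n -> R) (c : R) u v :
  (forall i j, A i j = A j i) ->
  (forall w, `|qform A w| <= c * sqnorm w) ->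
  `|bform A u v| <= c / 2 * (sqnorm u + sqnorm v).
Proof.
move=> sA cA.
have : 4 * bform A u v =
    qform A (fun i => u i + v i) - qform A (fun i => u i - v i).
  by rewrite (qform_add A u v) (qform_sub A u v) (bformC v u sA); ring.
have := cA (fun i => u i + v i); have := cA (fun i => u i - v i).
have := qform_parallelogram (fun i j => (i == j)%:R : R) u v.
rewrite -!sqnormE.
move: (qform _ _) (qform _ _) (sqnorm _) (sqnorm _) => x y z t h.
have -> : sqnorm u + sqnorm v = (z + t) / 2 by lra.
rewrite !ler_norml => /andP[? ?] /andP[? ?] ?.
by apply/andP; split; lra.
Qed.

(** With [P S P^T = 1], the trace is that of the square of [A = P T P^T], i.e. the sum
    of the squares of its entries. Each entry is at most [c], because the form of [A]
    is dominated by [c] times the squared norm. *)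
Lemma trace_sqr_le m (S T : 'M[R]_m) (c : R) : S^T = S -> T^T = T ->
  posdef S -> 0 <= c -> (forall u, `|mxform T u| <= c * mxform S u) ->
  \tr (T *m invmx S *m (T *m invmx S)) <= (m%:R * c) ^+ 2.
Proof.
move=> sS sT pS c0 TS; have [P PSP] := cholesky sS pS.
have Pu : P \in unitmx.
  by have [] := mulmx1_unit (etrans (mulmxA _ _ _) PSP).
have SV : invmx S = P^T *m P.
  have /mulmx1C H : P *m (S *m P^T) = 1%:M by rewrite mulmxA.
  have SPP : S *m (P^T *m P) = 1%:M by rewrite mulmxA.
  have [Su _] := mulmx1_unit SPP.
  by rewrite -[RHS](mulKmx Su) SPP mulmx1.
pose A := P *m T *m P^T.
have sA : A^T = A by rewrite /A !trmx_mul trmxK sT mulmxA.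
have -> : \tr (T *m invmx S *m (T *m invmx S)) = \tr (A *m A).
  by rewrite SV /A !mulmxA mxtrace_mulC !mulmxA.
have Aij i j : `|A i j| <= c.
  have qA w : `|qform (fun i j => A i j) w| <= c * sqnorm w.
    pose u : 'rV[R]_m := \row_i w i.
    have uw : (fun i => u ord0 i) = w by apply/funext => k; rewrite mxE.
    rewrite -uw -mxformE /A mxform_mul; apply: le_trans (TS _) _.
    rewrite -mxform_mul PSP mxformE sqnormE le_eqVlt; apply/orP; left; apply/eqP.
    by congr (_ * _); apply: eq_qform => k l; rewrite mxE.
  have sAij k l : A k l = A l k by rewrite -[in LHS]sA mxE.
  have := bform_le_sqnorm (fun k => (k == i)%:R) (fun k => (k == j)%:R) sAij qA.
  have sq1 (k : 'I_m) : sqnorm (fun l => (l == k)%:R) = 1 :> R.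
    rewrite /sqnorm (bigD1 k)//= eqxx expr1n big1 ?addr0// => l /negbTE ->.
    by rewrite expr0n.
  rewrite !sq1 -mulrA mulVf// mulr1.
  rewrite /bform (bigD1 i)//= (bigD1 j)//= !eqxx !mul1r.
  rewrite big1 => [|k /negbTE->]; last by rewrite mulr0 mul0r.
  rewrite big1 ?addr0// => k /negbTE->.
  by rewrite big1// => l _; rewrite !mul0r.
rewrite /mxtrace.
apply: (@le_trans _ _ (\sum_(i < m) \sum_(j < m) c ^+ 2)).
  apply: ler_sum => i _; rewrite mxE; apply: ler_sum => j _.
  rewrite expr2; apply: le_trans (ler_norm _) _.
  by rewrite normrM ler_pM.
rewrite !sumr_const card_ord -mulrnA -[leLHS]mulr_natl natrM exprMn.
by rewrite expr2.
Qed.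

End TraceBound.

(** * Bounds on the reference prior of a mixture kernel *)

Section PriorBound.
Variables (R : realType) (r n p : nat).
Variables (phi a : R -> R).
Local Notation mu := (@lebesgue_measure R).
Hypothesis phi_gt0 : forall u, 0 < phi u.
Hypothesis a_gt0 : forall u, 0 < a u.
Hypothesis measurable_a : measurable_fun [set: R] a.
Hypothesis integrable_phi : mu.-integrable [set: R] (EFin \o phi).
Variable K : R -> R.
Hypothesis K_mix : forall t, 0 <= t -> K t = gauss_mix phi a (t ^+ 2).
Hypothesis K0 : K 0 = 1.
Variables (x : 'I_n -> 'rV[R]_r) (W : 'M[R]_(n, n - p)).
Hypothesis x_inj : injective x.
Hypothesis W_orth : W^T *m W = 1%:M.
Implicit Types (theta : R) (v : 'I_n -> R).

Let X i l : R := x i ord0 l.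
Let d := dist2 X.

Let X_inj i j : (forall l, X i l = X j l) -> i = j.
Proof.
by move=> Xij; apply: x_inj; apply/rowP => l; exact: Xij.
Qed.

Let d_ge0 theta i j : 0 <= d i j / theta ^+ 2.
Proof. by rewrite divr_ge0 ?sqr_ge0// dist2_ge0. Qed.

Let cov theta i j := gauss_mix phi a (d i j / theta ^+ 2).
(** The derivative of [cov] in [theta] is [2 / theta * dcov]. *)
Let dcov theta i j := gauss_mix_weighted phi a (d i j / theta ^+ 2).

Lemma Sigma_mix theta : 0 < theta -> Sigma K x theta = \matrix_(i, j) cov theta i j.
Proof.
move=> t0; apply/matrixP => i j; rewrite !mxE K_mix; last first.
  by rewrite divr_ge0 ?sqrtr_ge0// ltW.
have -> : (euclidean_norm (x i - x j) / theta) ^+ 2 = d i j / theta ^+ 2.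
  rewrite expr_div_n sqr_sqrtr; last by apply: sumr_ge0 => l _; exact: sqr_ge0.
  by congr (_ / _); apply: eq_bigr => l _; rewrite !mxE.
by [].
Qed.

Lemma is_derive_SigmaW theta : 0 < theta ->
  is_derive theta 1 (SigmaW K x W)
    ((2 / theta) *: (W^T *m (\matrix_(i, j) dcov theta i j) *m W)).
Proof.
move=> t0.
pose S t := W^T *m (\matrix_(i, j) cov t i j) *m W.
have dS k l : is_derive theta 1 (fun t => S t k l)
    (((2 / theta) *: (W^T *m (\matrix_(i, j) dcov theta i j) *m W)) k l).
  rewrite (_ : (fun t => _) = \sum_j \sum_i
      (W i k * W j l) \*: (fun t => cov t i j)).
    apply: is_derive_eq.
      apply: is_derive_sum => j; apply: is_derive_sum => i.
      apply: is_deriveZ; apply: is_derive_gauss_mix => //; exact: dist2_ge0.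
    rewrite !mxE mulr_sumr; apply: eq_bigr => j _; rewrite !mxE mulr_suml mulr_sumr.
    by apply: eq_bigr => i _; rewrite !mxE /dcov /GRing.scale/=; ring.
  apply/funext => t; rewrite fct_sumE /S mxE; apply: eq_bigr => j _.
  rewrite fct_sumE !mxE mulr_suml; apply: eq_bigr => i _.
  by rewrite !mxE /GRing.scale/= mulrAC.
have dS' : derivable S theta 1.
  by apply/derivable_mxP => k l; case: (dS k l).
apply: (@near_eq_is_derive _ _ _ S).
  near=> t; rewrite /SigmaW Sigma_mix//.
  by near: t; exact: lt_nbhsr.
apply: DeriveDef => //; rewrite derive_mx//; apply/matrixP => k l.
by rewrite mxE; have Hd := dS k l; exact: derive_val.
Unshelve. all: by end_near. Qed.

Lemma sqnorm_mulW (u : 'rV[R]_(n - p)) : u != 0 ->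
  0 < sqnorm (fun i => (u *m W^T) ord0 i).
Proof.
move=> u0; rewrite lt_neqAle sqnorm_ge0 andbT eq_sym.
apply: contra_neq u0 => N0.
have uW : u *m W^T = 0.
  apply/rowP => i; rewrite [RHS]mxE.
  by apply: (sqnorm_eq0 (v := fun i => (u *m W^T) ord0 i)); rewrite N0.
by rewrite -(mulmx1 u) -W_orth mulmxA uW mul0mx.
Qed.

(** The subtracted square is dropped, and [trace_sqr_le] is applied to the projected
    matrices. *)
Lemma prior_le theta (c : R) : 0 < theta -> 0 <= c ->
  (forall v, 0 < sqnorm v -> 0 < qform (cov theta) v) ->
  (forall v, `|qform (dcov theta) v| <= c * qform (cov theta) v) ->
  reference_prior K x W theta <= (n - p)%:R * (2 / theta * c).
Proof.
move=> t0 c0 pcov dcov_le.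
have D := is_derive_SigmaW t0.
rewrite /reference_prior derive1E derive_val /SigmaW Sigma_mix//.
set T := _ *: _; set S := W^T *m _ *m W.
have SE u : mxform S u = qform (cov theta) (fun i => (u *m W^T) ord0 i).
  rewrite /S -{2}(trmxK W) mxform_mul mxformE.
  by apply: eq_qform => i j; rewrite mxE.
have TE u : mxform T u =
    2 / theta * qform (dcov theta) (fun i => (u *m W^T) ord0 i).
  rewrite /T /mxform -scalemxAr -scalemxAl mxE; congr (_ * _).
  rewrite -/(mxform _ _) -{2}(trmxK W) mxform_mul mxformE.
  by apply: eq_qform => i j; rewrite mxE.
have sym (f : R -> R) : (W^T *m (\matrix_(i, j) f (d i j)) *m W)^T =
    W^T *m (\matrix_(i, j) f (d i j)) *m W.
  rewrite !trmx_mul trmxK mulmxA; congr (_ *m _ *m _).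
  by apply/matrixP => i j; rewrite !mxE /d dist2C.
have sS : S^T = S by exact: (sym (fun e => gauss_mix phi a (e / theta ^+ 2))).
have sT : T^T = T.
  rewrite /T linearZ/=; congr (_ *: _).
  exact: (sym (fun e => gauss_mix_weighted phi a (e / theta ^+ 2))).
have pS : posdef S by move=> u u0; rewrite SE; apply/pcov/sqnorm_mulW.
have c'0 : 0 <= 2 / theta * c by rewrite mulr_ge0// divr_ge0// ltW.
have TS u : `|mxform T u| <= (2 / theta * c) * mxform S u.
  rewrite TE SE normrM ger0_norm ?divr_ge0 ?(ltW t0)// -[leRHS]mulrA.
  by rewrite ler_wpM2l ?divr_ge0 ?(ltW t0).
have mc0 : 0 <= (n - p)%:R * (2 / theta * c) by rewrite mulr_ge0.
rewrite -[leRHS]ger0_norm// -sqrtr_sqr.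
rewrite ler_wsqrtr//; apply: le_trans (trace_sqr_le sS sT pS c'0 TS).
by rewrite gerBl mulr_ge0 ?invr_ge0// sqr_ge0.
Qed.

Let cov_integral theta v : 0 < theta ->
  mu.-integrable [set: R]
    (EFin \o (fun u => phi u * qform (gauss X (a u / theta ^+ 2)) v)) /\
  qform (cov theta) v = \int[mu]_u (phi u * qform (gauss X (a u / theta ^+ 2)) v).
Proof.
move=> t0.
have [] := @qform_Rintegral R n (fun u i j => phi u *
  expR (- (a u * (d i j / theta ^+ 2)))) v.
  by move=> i j; apply: integrable_gauss.
have E : (fun u => qform (fun i j =>
      phi u * expR (- (a u * (d i j / theta ^+ 2)))) v) = (fun u =>
    phi u * qform (gauss X (a u / theta ^+ 2)) v).
  apply/funext => u; rewrite /qform -bformZ; apply: eq_bform => i j; rewrite /gauss.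
  by rewrite mulrA mulrAC.
by move=> + ->; rewrite E.
Qed.

Let dcov_integral theta v : 0 < theta ->
  mu.-integrable [set: R]
    (EFin \o (fun u => phi u * qform (gauss_weighted X (a u / theta ^+ 2)) v)) /\
  qform (dcov theta) v =
    \int[mu]_u (phi u * qform (gauss_weighted X (a u / theta ^+ 2)) v).
Proof.
move=> t0.
have [] := @qform_Rintegral R n (fun u i j => phi u *
  (a u * (d i j / theta ^+ 2) * expR (- (a u * (d i j / theta ^+ 2))))) v.
  by move=> i j; apply: integrable_gauss_weighted.
have E : (fun u => qform (fun i j => phi u *
      (a u * (d i j / theta ^+ 2) * expR (- (a u * (d i j / theta ^+ 2))))) v) =
    (fun u => phi u * qform (gauss_weighted X (a u / theta ^+ 2)) v).
  apply/funext => u; rewrite /qform -bformZ; apply: eq_bform => i j; rewrite /gauss_weighted /gauss.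
  by rewrite (_ : a u * (d i j / theta ^+ 2) = a u / theta ^+ 2 * dist2 X i j) // mulrA mulrAC.
by move=> + ->; rewrite E.
Qed.

Let scale_gt0 theta u : 0 < theta -> 0 < a u / theta ^+ 2.
Proof. by move=> t0; rewrite divr_gt0// exprn_gt0. Qed.

Lemma cov_posdef theta v : 0 < theta -> 0 < sqnorm v -> 0 < qform (cov theta) v.
Proof.
move=> t0 v0; have [intf ->] := cov_integral v t0.
apply: Rintegral_gt0 => // u; rewrite mulr_gt0//.
have [c c0 cP] := gauss_form_ge X_inj (scale_gt0 u t0).
by apply: lt_le_trans (cP _ v (lexx _)); rewrite mulr_gt0.
Qed.

(** [gauss_weighted_dominated] holds with the same constant at all the scales
    [a u / theta ^+ 2], so it can be integrated in [u]. *)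
Lemma dcov_dominated : exists2 C : R, 0 <= C & forall theta v, 0 < theta ->
  `|qform (dcov theta) v| <= C * qform (cov theta) v.
Proof.
have [C C0 CP] := gauss_weighted_dominated X_inj.
exists C => // theta v t0.
have [intf ->] := cov_integral v t0; have [intg ->] := dcov_integral v t0.
apply: le_trans (le_normr_Rintegral measurableT intg) _.
rewrite -RintegralZl//; apply: le_Rintegral => //.
- exact: integrable_norm intg.
- rewrite (_ : _ \o _ = (fun u => C%:E *
    (phi u * qform (gauss X (a u / theta ^+ 2)) v)%:E)%E).
    exact: integrableZl intf.
  by apply/funext => u /=; rewrite EFinM.
move=> u _; rewrite normrM gtr0_norm// mulrCA ler_wpM2l ?(ltW (phi_gt0 u))//.
by apply: CP; exact: scale_gt0.
Qed.

Lemma prior_le_inv : exists C : R, forall theta, 0 < theta ->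
  reference_prior K x W theta <= C / theta.
Proof.
have [C C0 CP] := dcov_dominated.
exists ((n - p)%:R * (2 * C)) => theta t0.
have -> : (n - p)%:R * (2 * C) / theta = (n - p)%:R * (2 / theta * C) by ring.
by apply: prior_le => // v; [exact: cov_posdef|exact: CP].
Qed.

Let separation : exists2 delta : R, 0 < delta & forall i j, i != j -> delta <= d i j.
Proof.
have [M M1 MP] := finite_bound (fun ij : 'I_n * 'I_n => (d ij.1 ij.2)^-1).
have M0 : 0 < M by exact: lt_le_trans M1.
exists M^-1 => [|i j ij]; first by rewrite invr_gt0.
have dij : 0 < d i j.
  rewrite lt_neqAle dist2_ge0 andbT eq_sym; apply: contra_neq ij => d0.
  apply: X_inj => l; apply/eqP; rewrite -subr_eq0 -sqrf_eq0.
  have : d i j == 0 by rewrite d0.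
  rewrite psumr_eq0 => [/allP/(_ l (mem_index_enum l))//|k _]; exact: sqr_ge0.
rewrite -[leRHS]invrK lef_pV2 ?posrE ?invr_gt0//.
by have := MP (i, j); rewrite ger0_norm ?invr_ge0 ?(ltW dij).
Qed.

Lemma gauss_mix_antitone e e' : 0 <= e <= e' -> gauss_mix phi a e' <= gauss_mix phi a e.
Proof.
move=> /andP[e0 ee']; apply: le_Rintegral => //.
- by apply: integrable_gauss => //; exact: le_trans ee'.
- exact: integrable_gauss.
move=> u _; rewrite ler_wpM2l ?(ltW (phi_gt0 u))// ler_expR lerN2.
by rewrite ler_wpM2l// ltW.
Qed.

Lemma gauss_mix_ge0 e : 0 <= gauss_mix phi a e.
Proof. by apply: Rintegral_ge0 => u _; rewrite mulr_ge0 ?expR_ge0// ltW. Qed.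

Lemma gauss_mix_weighted_ge0 e : 0 <= e -> 0 <= gauss_mix_weighted phi a e.
Proof.
move=> e0; apply: Rintegral_ge0 => u _.
by have ? := ltW (phi_gt0 u); have ? := ltW (a_gt0 u); rewrite !mulr_ge0 ?expR_ge0.
Qed.

(** From [q * e^-q = 2 * ((q / 2) * e^(- q / 2)) * e^(- q / 2)] and [y * e^-y <= 1]. *)
Lemma gauss_mix_weighted_le e : 0 <= e ->
  gauss_mix_weighted phi a e <= 2 * gauss_mix phi a (e / 2).
Proof.
move=> e0; have e20 : 0 <= e / 2 by rewrite divr_ge0.
rewrite /gauss_mix /mixture -RintegralZl//; last exact: integrable_gauss.
apply: le_Rintegral => //.
- exact: integrable_gauss_weighted.
- rewrite (_ : _ \o _ = (fun u => 2%:E *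
    (phi u * expR (- (a u * (e / 2))))%:E)%E).
    by apply: integrableZl => //; exact: integrable_gauss.
  by apply/funext => u /=; rewrite EFinM.
move=> u _; rewrite [leRHS]mulrCA ler_wpM2l ?(ltW (phi_gt0 u))//.
pose q := a u * (e / 2).
have -> : a u * e = q + q by rewrite /q; field.
have q0 : 0 <= q by rewrite mulr_ge0// ltW.
have -> : (q + q) * expR (- (q + q)) = 2 * (q * expR (- q) * expR (- q)).
  by rewrite opprD expRD; ring.
rewrite ler_wpM2l// ler_piMl ?expR_ge0//.
by apply: le_trans (ler_norm _) (mul_expRN_le1 q0).
Qed.

(** With [kap theta] the kernel at half the squared separation, the covariance differs
    from the identity by entries at most [kap theta], and the entries of [dcov] are
    at most [2 * kap theta]. Once [n * kap theta <= 1 / 2], the covariance form is at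
    least half the squared norm, so the constant in [prior_le] is a multiple of
    [kap theta]. *)
Lemma prior_le_powR (k C : R) : 0 < k -> 0 <= C ->
  (forall e, 0 < e -> gauss_mix phi a e <= C * e `^ (- k)) ->
  exists D : R, \forall theta \near 0^'+,
    reference_prior K x W theta <= D * theta `^ (2 * k - 1).
Proof.
move=> k0 C0 decay; have [delta delta0 deltaP] := separation.
pose kap theta := gauss_mix phi a (delta / 2 / theta ^+ 2).
pose B := C * (delta / 2) `^ (- k).
have B0 : 0 <= B by rewrite mulr_ge0// powR_ge0.
have kap0 theta : 0 <= kap theta by exact: gauss_mix_ge0.
have kapB theta : 0 < theta -> kap theta <= B * theta `^ (2 * k).
  move=> t0; apply: le_trans (decay _ _) _.
    by rewrite !divr_gt0// exprn_gt0.
  rewrite -[leRHS]mulrA ler_wpM2l// powRM ?invr_ge0 ?sqr_ge0 ?divr_ge0 ?(ltW delta0)//.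
  rewrite -powR_invn ?(ltW t0)// -powRrM mulrNN.
  by rewrite lexx.
exists ((n - p)%:R * (2 * (4 * n%:R * B))).
have n2_gt0 : 0 < (2 * n.+1%:R)^-1 :> R by rewrite invr_gt0 mulr_gt0.
have small : \forall theta \near 0^'+, B * theta `^ (2 * k) < (2 * n.+1%:R)^-1.
  have k20 : 0 < 2 * k by rewrite mulr_gt0.
  have : B * theta `^ (2 * k) @[theta --> 0^'+] --> B * 0.
    by apply: cvgMr; exact: powR_cvg0.
  by rewrite mulr0 => /cvgr_lt; apply.
near=> theta.
have t0 : 0 < theta by near: theta; exact: nbhs_right_gt.
have nkap : n%:R * kap theta <= 1 / 2.
  have : kap theta < (2 * n.+1%:R)^-1.
    by apply: le_lt_trans (kapB _ t0) _; near: theta.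
  move=> /ltW /(ler_wpM2l (ler0n R n.+1)).
  rewrite invfM mulrCA mulfV ?pnatr_eq0// => h.
  have : n%:R * kap theta <= n.+1%:R * kap theta by rewrite ler_wpM2r// ler_nat.
  lra.
have dcov_le i j : `|dcov theta i j| <= 2 * kap theta.
  rewrite ger0_norm ?gauss_mix_weighted_ge0//.
  have [<-|/deltaP dij] := eqVneq i j.
    rewrite /dcov /d dist2ii mul0r /gauss_mix_weighted /mixture.
    under eq_Rintegral do rewrite mulr0 mul0r mulr0.
    by rewrite Rintegral_cst// mul0r mulr_ge0.
  apply: le_trans (gauss_mix_weighted_le (d_ge0 _ _ _)) _.
  rewrite ler_wpM2l//; apply: gauss_mix_antitone.
  rewrite divr_ge0 ?sqr_ge0 ?divr_ge0 ?(ltW delta0)//=.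
  by rewrite mulrAC ler_wpM2r// ler_wpM2r// invr_ge0 sqr_ge0.
(* The diagonal of the covariance is [K 0 = 1]. *)
pose off i j := cov theta i j - (i == j)%:R.
have off_le i j : `|off i j| <= kap theta.
  rewrite /off; have [<-|/deltaP dij] := eqVneq i j.
    rewrite /cov /d dist2ii mul0r -[X in _ - X]K0 K_mix// expr0n/=.
    by rewrite subrr normr0.
  rewrite subr0 ger0_norm ?gauss_mix_ge0//; apply: gauss_mix_antitone.
  rewrite divr_ge0 ?sqr_ge0 ?divr_ge0 ?(ltW delta0)//=.
  rewrite ler_wpM2r ?invr_ge0 ?sqr_ge0//.
  by move: delta0 dij; lra.
have cov_ge v : sqnorm v / 2 <= qform (cov theta) v.
  rewrite (eq_qform _ (B := fun i j => (i == j)%:R + off i j)); last first.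
    by move=> i j; rewrite addrC subrK.
  rewrite /qform bformD -![bform _ v v]/(qform _ v) -sqnormE.
  have := qform_le_sqnorm v off_le.
  have := ler_wpM2r (sqnorm_ge0 v) nkap.
  by rewrite ler_norml => ? /andP[]; lra.
have c0 : 0 <= 4 * n%:R * kap theta by rewrite !mulr_ge0.
apply: le_trans (prior_le t0 c0 _ _) _ => [v|v|].
- exact: cov_posdef.
- apply: le_trans (qform_le_sqnorm v dcov_le) _.
  have := ler_wpM2l c0 (cov_ge v); lra.
apply: (@le_trans _ _ ((n - p)%:R *
    (2 / theta * (4 * n%:R * (B * theta `^ (2 * k)))))).
  do 2 (rewrite ler_wpM2l ?divr_ge0 ?(ltW t0)//).
  by rewrite ler_wpM2l ?mulr_ge0//; exact: kapB.
have -> : theta `^ (2 * k) = theta * theta `^ (2 * k - 1).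
  by rewrite mulr_powRB1 ?(ltW t0)// mulr_gt0.
rewrite le_eqVlt; apply/orP; left; apply/eqP.
by move: (_ `^ _) (B) => y z; field; rewrite gt_eqF.
Unshelve. all: by end_near. Qed.

End PriorBound.

(** * Changes of variables and the Gamma integral *)

Section ChangeOfVariables.
Variable R : realType.
Local Notation mu := (@lebesgue_measure R).

(** This turns integrals over the whole line, which can be translated, into integrals
    over the half-line such as the one defining the Bessel function. *)
Lemma ge0_integral_fold (f : R -> \bar R) : measurable_fun [set: R] f ->
  (forall u, 0 <= f u)%E ->
  (\int[mu]_u f u = \int[mu]_(u in `[0%R, +oo[) (f u + f (- u)%R))%E.
Proof.
move=> mf f0.
have mfN : measurable_fun [set: R] (fun u => f (- u)).
  by apply: measurableT_comp => //; exact: measurable_funN.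
rewrite ge0_integralD//; [|exact: measurable_funTS..].
rewrite [in X in (_ + X)%E]ge0_integration_by_substitution0//.
under [in X in (_ + X)%E]eq_integral do rewrite opprK.
have -> : [set: R] = `]-oo, 0%R] `|` `]0%R, +oo[.
  by rewrite -itv_bndbnd_setU ?set_itvNyy.
rewrite ge0_integral_setU//.
- rewrite addeC; congr (_ + _)%E; rewrite integral_itv_obnd_cbnd//.
  exact: measurable_funTS.
- exact: measurable_funTS.
- apply/disj_setPS => y [/=]; rewrite !in_itv/= andbT => y0.
  by rewrite ltNge y0.
Qed.

Lemma Rintegral_fold (f : R -> R) : continuous f -> (forall u, 0 <= f u) ->
  \int[mu]_u f u = \int[mu]_(u in `[0, +oo[) (f u + f (- u)).
Proof.
move=> cf f0; rewrite /Rintegral ge0_integral_fold//.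
apply/measurable_EFinP; exact: continuous_measurable_fun.
Qed.

Lemma Rintegral_shift (f : R -> R) (c : R) : continuous f -> (forall u, 0 <= f u) ->
  \int[mu]_u f u = \int[mu]_u f (u + c).
Proof.
move=> cf f0; rewrite /Rintegral; congr fine.
have dshift : derive1 (fun u : R => u + c) = cst 1.
  apply/funext => u; rewrite derive1E.
  have H : is_derive u 1 (id + cst c) (1 + 0) by exact: is_deriveD.
  by rewrite -[LHS]/('D_1 (id + cst c) u) derive_val addr0.
rewrite (@increasing_ge0_integration_by_substitutionT _ (fun u => u + c))//.
- by apply: eq_integral => u _ /=; rewrite dshift mulr1.
- by move=> u v; rewrite ltrD2r.
- by rewrite dshift; exact: cst_continuous.
- by rewrite dshift; exact: is_cvg_cst.
- by rewrite dshift; exact: is_cvg_cst.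
- by apply: cvg_addrr_Ny.
- by apply: cvg_addrr.
Qed.

End ChangeOfVariables.

Section GammaDensity.
Variable R : realType.
Local Notation mu := (@lebesgue_measure R).
Implicit Types nu u : R.

(** The integrand of the Gamma function after the substitution [s = expR u],
    Jacobian included. *)
Definition log_gamma_kernel nu u : R := expR (nu * u - expR u).

Local Notation gam := log_gamma_kernel.

Lemma continuous_log_gamma_kernel nu : continuous (gam nu).
Proof.
move=> u; apply: continuous_comp; last exact: continuous_expR.
apply: cvgB; last exact: continuous_expR.
by apply: cvgMr; exact: cvg_id.
Qed.

(** On the right half-line [expR u >= a * (1 + u - ln a)] with [a = nu + 1] gives a
    bound by a multiple of [expR (- u)]; on the left one, [expR (nu * u)] is a bound. *)
Lemma integrable_log_gamma_kernel nu : 0 < nu ->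
  mu.-integrable [set: R] (EFin \o gam nu).
Proof.
move=> nu0; apply/integrableP; split.
  by apply/measurable_EFinP; apply: continuous_measurable_fun; exact: continuous_log_gamma_kernel.
under eq_integral do rewrite /= ger0_norm ?expR_ge0//.
rewrite ge0_integral_fold//; last by move=> u; rewrite lee_fin expR_ge0.
  pose nu1 := nu + 1.
  have nu10 : 0 < nu1 by rewrite addr_gt0.
  pose D u := expR (nu1 * ln nu1 - nu1) * exponential_pdf 1 u +
              nu^-1 * exponential_pdf nu u.
  have intD : mu.-integrable [set: R] (EFin \o D).
    rewrite (_ : _ \o _ = (fun u => (expR (nu1 * ln nu1 - nu1))%:E *
        (exponential_pdf 1 u)%:E + nu^-1%:E * (exponential_pdf nu u)%:E)%E).
      by apply: integrableD => //; apply: integrableZl => //; exact: integrable_exponential_pdf.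
    by apply/funext => u.
  have intD0 : mu.-integrable `[0%R, +oo[ (EFin \o D).
    by apply: integrableS intD.
  have Dlty : (\int[mu]_(u in `[0%R, +oo[) (D u)%:E < +oo)%E.
    by rewrite ltey_eq (integrable_fin_num _ intD0).
  apply: le_lt_trans Dlty.
  apply: ge0_le_integral => //.
  - by move=> u _; rewrite adde_ge0// lee_fin expR_ge0.
  - apply: measurable_funTS; apply: emeasurable_funD.
      by apply/measurable_EFinP; apply: continuous_measurable_fun; exact: continuous_log_gamma_kernel.
    apply/measurable_EFinP; apply: measurableT_comp => //.
    by apply: continuous_measurable_fun; exact: continuous_log_gamma_kernel.
  - exact: measurable_int intD0.
  move=> u; rewrite /= in_itv/= andbT => u0.
  rewrite lee_fin /D lerD//.
    rewrite exponential_pdfE// mul1r -expRD ler_expR.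
    have := expR_ge1Dx (u - ln nu1).
    rewrite expRB lnK ?posrE// ler_pdivlMr// => h.
    by rewrite /nu1 in h *; lra.
  rewrite exponential_pdfE// mulrA mulVf ?gt_eqF// mul1r ler_expR.
  by rewrite mulrN mulNr gerBl expR_ge0.
by apply/measurable_EFinP; apply: continuous_measurable_fun; exact: continuous_log_gamma_kernel.
Qed.

(** The substitution is made on the compact intervals [- k, k], where the derivative of
    the exponential stays bounded, and followed by a monotone limit. *)
Lemma Gamma_log_gamma nu : Gamma nu = \int[mu]_u gam nu u.
Proof.
rewrite /Gamma /Rintegral; congr fine.
pose G s : R := s `^ (nu - 1) * expR (- s).
pose E k : set R := `[- k%:R, k%:R]%classic.
pose F k : set R := `[expR (- k%:R), expR k%:R]%classic.
have dexp : derive1 (@expR R) = expR.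
  by apply/funext => u; rewrite derive1E derive_val.
have EFk k : (\int[mu]_(s in F k) (G s)%:E = \int[mu]_(u in E k) (gam nu u)%:E)%E.
  rewrite /F /E integration_by_substitution_increasing//.
  - apply: eq_integral => u _; congr EFin; rewrite !fctE dexp.
    rewrite /G /gam -expRM -!expRD; congr expR.
    by ring.
  - by rewrite (@le_trans _ _ 0)// oppr_le0.
  - by move=> u v _ _; rewrite ltr_expR.
  - by rewrite dexp => u _; exact: continuous_expR.
  - rewrite dexp; apply/cvg_ex; exists (expR (- k%:R)).
    by apply: cvg_at_right_filter; exact: continuous_expR.
  - rewrite dexp; apply/cvg_ex; exists (expR k%:R).
    by apply: cvg_at_left_filter; exact: continuous_expR.
  - split; first by move=> u _; exact: derivable_expR.
      by apply: cvg_at_right_filter; exact: continuous_expR.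
    by apply: cvg_at_left_filter; exact: continuous_expR.
  apply: derivable_within_continuous => s.
  rewrite in_itv/= => /andP[/(lt_le_trans (expR_gt0 _)) s0 _].
  have H1 := is_derive1_powR (nu - 1) s0.
  apply: derivableM; first by case: H1.
  have H2 : is_derive s 1 (expR \o -%R) (expR (- s) * -1).
    by apply: is_derive1_comp.
  by case: H2.
have FU : \bigcup_k F k = `]0, +oo[%classic.
  apply/seteqP; split=> [s [k _]|s]; rewrite /F /= !in_itv/= ?andbT.
    by move=> /andP[+ _]; apply: lt_le_trans; exact: expR_gt0.
  move=> s0; exists (Num.Def.archi_bound `|ln s|) => //=.
  rewrite /F /= in_itv/= -{2 3}(lnK (x := s)) ?posrE// !ler_expR -ler_norml.
  by apply/ltW/archi_boundP.
have EU : \bigcup_k E k = [set: R].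
  apply/seteqP; split=> // u _; exists (Num.Def.archi_bound `|u|) => //=.
  by rewrite /E /= in_itv/= -ler_norml; apply/ltW/archi_boundP.
have leN (k l : nat) : (k <= l)%N -> - l%:R <= - k%:R :> R by rewrite lerN2 ler_nat.
have homF : {homo F : k l / (k <= l)%N >-> (k <= l)%O}.
  move=> k l kl; apply/subsetPset => s; rewrite /F /= !in_itv/= => /andP[sk ks].
  by rewrite (le_trans _ sk) ?(le_trans ks)// ler_expR ?ler_nat ?leN.
have homE : {homo E : k l / (k <= l)%N >-> (k <= l)%O}.
  move=> k l kl; apply/subsetPset => s; rewrite /E /= !in_itv/= => /andP[sk ks].
  by rewrite (le_trans _ sk) ?(le_trans ks)// ?ler_nat ?leN.
have mG : measurable_fun [set: R] G.
  apply: measurable_funM; first exact: measurable_powR.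
  by apply: measurableT_comp => //; exact: measurable_funN.
have mgam : measurable_fun [set: R] (gam nu).
  by apply: continuous_measurable_fun; exact: continuous_log_gamma_kernel.
have /cvg_lim cF : (\int[mu]_(s in F k) (G s)%:E)%E @[k --> \oo] -->
    (\int[mu]_(s in \bigcup_k F k) (G s)%:E)%E.
  apply: ge0_nondecreasing_set_cvg_integral => //.
  - by move=> k; exact: measurable_itv.
  - by move=> k; apply/measurable_EFinP/measurable_funTS.
  - by move=> k s _; rewrite lee_fin mulr_ge0 ?powR_ge0 ?expR_ge0.
have /cvg_lim cE : (\int[mu]_(u in E k) (gam nu u)%:E)%E @[k --> \oo] -->
    (\int[mu]_(u in \bigcup_k E k) (gam nu u)%:E)%E.
  apply: ge0_nondecreasing_set_cvg_integral => //.
  - by move=> k; exact: measurable_itv.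
  - by move=> k; apply/measurable_EFinP/measurable_funTS.
  - by move=> k u _; rewrite lee_fin expR_ge0.
rewrite -EU -FU -cF// -cE//; congr (limn _).
by apply/funext => k.
Qed.

End GammaDensity.

(** * The three kernels as mixtures of Gaussian kernels *)

Section KernelMixtures.
Variable R : realType.
Local Notation mu := (@lebesgue_measure R).
Local Notation gam := (@log_gamma_kernel R).
Implicit Types nu t u e : R.

Lemma Gamma_gt0 nu : 0 < nu -> 0 < Gamma nu.
Proof.
move=> nu0; rewrite Gamma_log_gamma.
by apply: Rintegral_gt0; [exact: integrable_log_gamma_kernel|move=> u; exact: expR_gt0].
Qed.

Definition log_gamma_pdf nu u : R := (Gamma nu)^-1 * gam nu u.

Lemma log_gamma_pdf_gt0 nu u : 0 < nu -> 0 < log_gamma_pdf nu u.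
Proof. by move=> nu0; rewrite mulr_gt0 ?invr_gt0 ?Gamma_gt0 ?expR_gt0. Qed.

Lemma integrable_log_gamma_pdf nu : 0 < nu ->
  mu.-integrable [set: R] (EFin \o log_gamma_pdf nu).
Proof.
move=> nu0; rewrite (_ : _ \o _ = (fun u => (Gamma nu)^-1%:E * (gam nu u)%:E)%E).
  by apply: integrableZl => //; exact: integrable_log_gamma_kernel.
by apply/funext => u.
Qed.

Lemma Rintegral_log_gamma_pdf nu : 0 < nu -> \int[mu]_u log_gamma_pdf nu u = 1.
Proof.
move=> nu0; rewrite RintegralZl//; last exact: integrable_log_gamma_kernel.
by rewrite -Gamma_log_gamma mulVf// gt_eqF// Gamma_gt0.
Qed.

Lemma gauss_mix0 nu a : 0 < nu -> gauss_mix (log_gamma_pdf nu) a 0 = 1.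
Proof.
move=> nu0; rewrite -(Rintegral_log_gamma_pdf nu0); apply: eq_Rintegral => u _.
by rewrite mulr0 oppr0 expR0 mulr1.
Qed.

Lemma squared_exponential_mix t :
  squared_exponential t = gauss_mix (log_gamma_pdf 1) (cst 1) (t ^+ 2).
Proof.
transitivity (\int[mu]_u (log_gamma_pdf 1 u * expR (- t ^+ 2))).
  rewrite RintegralZr//; last exact: integrable_log_gamma_pdf.
  by rewrite Rintegral_log_gamma_pdf// mul1r.
by apply: eq_Rintegral => u _; rewrite /cst mul1r.
Qed.

(** Translating [u] by [ln (1 + e)] turns [expR u * (1 + e)] into [expR u]. *)
Lemma rational_quadratic_mix nu e : 0 < nu -> 0 <= e ->
  gauss_mix (log_gamma_pdf nu) (@expR R) e = (1 + e) `^ (- nu).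
Proof.
move=> nu0 e0; have e1 : 0 < 1 + e by rewrite ltr_wpDr.
have cgam := @continuous_log_gamma_kernel R nu.
have intg := integrable_log_gamma_kernel nu0.
pose h u := (1 + e) `^ (- nu) * log_gamma_pdf nu u.
have ch : continuous h by move=> u; do 2 apply: cvgMr; exact: cgam.
have h0 u : 0 <= h u.
  by rewrite mulr_ge0 ?powR_ge0// ltW// log_gamma_pdf_gt0.
transitivity (\int[mu]_u h (u + ln (1 + e))).
  apply: eq_Rintegral => u _; rewrite /h /log_gamma_pdf -mulrA [RHS]mulrCA; congr (_ * _).
  rewrite /log_gamma_kernel /powR gt_eqF// -!expRD; congr expR.
  by rewrite expRD lnK ?posrE//; ring.
rewrite -(Rintegral_shift _ ch h0) RintegralZl//; last first.
  exact: integrable_log_gamma_pdf.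
by rewrite Rintegral_log_gamma_pdf// mulr1.
Qed.

Lemma measurable_expRN : measurable_fun [set: R] (fun u => expR (- u)).
Proof. by apply: measurableT_comp => //; exact: measurable_funN. Qed.

Lemma integrable_bessel_density nu (y : R) : 0 < nu -> 0 <= y ->
  mu.-integrable [set: R]
    (EFin \o (fun u => gam nu u * expR (- (expR (- u) * y)))).
Proof.
move=> nu0 y0; apply: (@integrable_gauss _ (gam nu) (fun u => expR (- u))) => //.
- by move=> u; exact: expR_gt0.
- exact: measurable_expRN.
- exact: integrable_log_gamma_kernel.
Qed.

(** Unfold the even integrand to [expR (nu * u - z * cosh u) / 2] on the whole line,
    then translate by [ln (z / 2)]: the growing half of [z * cosh u] becomes [expR u]
    and the decaying half becomes [(z / 2) ^+ 2 * expR (- u)]. *)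
Lemma besselK_log_gamma nu z : 0 < nu -> 0 < z ->
  besselK nu z = 2^-1 * (z / 2) `^ (- nu) *
    \int[mu]_u (gam nu u * expR (- (expR (- u) * (z / 2) ^+ 2))).
Proof.
move=> nu0 z0; have z20 : 0 < z / 2 by rewrite divr_gt0.
have coshN u : cosh (- u) = cosh u by rewrite /cosh opprK addrC.
pose f u := 2^-1 * expR (nu * u - z * cosh u).
have cf : continuous f.
  move=> u; apply: cvgMr; apply: continuous_comp; last exact: continuous_expR.
  apply: cvgB; apply: cvgMr; first exact: cvg_id.
  apply: cvgMl; apply: cvgD; first exact: continuous_expR.
  by apply: continuous_comp; [exact: opp_continuous|exact: continuous_expR].
have f0 u : 0 <= f u by rewrite mulr_ge0 ?expR_ge0.
transitivity (\int[mu]_u f u).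
  rewrite Rintegral_fold//; apply: eq_Rintegral => u _.
  by rewrite /f coshN mulrN !expRD /cosh; ring.
rewrite (Rintegral_shift (- ln (z / 2)) cf f0).
pose w u := gam nu u * expR (- (expR (- u) * (z / 2) ^+ 2)).
transitivity (\int[mu]_u (2^-1 * (z / 2) `^ (- nu) * w u)).
  apply: eq_Rintegral => u _; rewrite /f /w /log_gamma_kernel /powR gt_eqF//.
  rewrite -[RHS]mulrA -!expRD; congr (_ * expR _).
  rewrite /cosh opprD opprK !expRD expRN lnK ?posrE//.
  by field; rewrite gt_eqF.
rewrite RintegralZl//; apply: integrable_bessel_density => //.
exact: sqr_ge0.
Qed.

(** The prefactor of the kernel cancels [(z / 2) `^ (- nu) / 2] exactly, and
    [(z / 2) ^+ 2 = nu * t ^+ 2] for [z = 2 * sqrt nu * t]. *)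
Lemma matern_mix nu t : 0 < nu -> 0 <= t ->
  matern nu t = gauss_mix (log_gamma_pdf nu) (fun u => nu * expR (- u)) (t ^+ 2).
Proof.
move=> nu0; rewrite le_eqVlt => /predU1P[<-|t0].
  by rewrite /matern eqxx expr0n/= gauss_mix0.
pose y := Num.sqrt nu * t.
have s0 : 0 < Num.sqrt nu by rewrite sqrtr_gt0.
have y0 : 0 < y by rewrite mulr_gt0.
have y2 : y ^+ 2 = nu * t ^+ 2 by rewrite exprMn sqr_sqrtr// ltW.
rewrite /matern gt_eqF// (_ : 2 * Num.sqrt nu * t = 2 * y); last by rewrite mulrA.
have y22 : 2 * y / 2 = y by field.
rewrite besselK_log_gamma ?y22 ?y2 ?mulr_gt0//.
set I := Rintegral _ _ _.
have -> : gauss_mix (log_gamma_pdf nu) (fun u => nu * expR (- u)) (t ^+ 2) =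
    (Gamma nu)^-1 * I.
  rewrite /I -RintegralZl//; last first.
    by apply: integrable_bessel_density => //; rewrite -y2 sqr_ge0.
  apply: eq_Rintegral => u _; rewrite /log_gamma_pdf [RHS]mulrA.
  by congr (_ * expR (- _)); rewrite mulrAC mulrC mulrCA.
rewrite mulrA; congr (_ * _); rewrite -[RHS]mulr1 -!mulrA; congr (_ * _).
have -> : 2 `^ (1 - nu) = 2 / 2 `^ nu :> R.
  by rewrite powRB ?powRr1// pnatr_eq0 implybT.
rewrite powRN (powRM _ _ (ltW y0))//.
have : y `^ nu != 0 by rewrite gt_eqF// powR_gt0.
have : 2 `^ nu != 0 :> R by rewrite gt_eqF// powR_gt0.
move: (y `^ nu) (2 `^ nu) => p q q0 p0.
by field; rewrite q0 p0.
Qed.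

Lemma expRN_le_inv (q : R) : 0 < q -> expR (- q) <= q^-1.
Proof.
move=> q0; rewrite -[leRHS]mul1r ler_pdivlMr// mulrC.
exact: le_trans (ler_norm _) (mul_expRN_le1 (ltW q0)).
Qed.

(** From [e^-q <= 1 / q] with [q = nu * expR (- u) * e]: the factor [expR u] of [1 / q]
    shifts the order of the log-Gamma integrand by one. *)
Lemma matern_decay nu : 0 < nu -> exists2 C : R, 0 <= C & forall e, 0 < e ->
  gauss_mix (log_gamma_pdf nu) (fun u => nu * expR (- u)) e <= C * e `^ (- 1).
Proof.
move=> nu0; have nu10 : 0 < nu + 1 by rewrite addr_gt0.
exists (Gamma (nu + 1) / (nu * Gamma nu)) => [|e e0].
  by rewrite divr_ge0 ?mulr_ge0// ltW// Gamma_gt0.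
pose c := (Gamma nu * (nu * e))^-1.
rewrite powRN powRr1 ?(ltW e0)//.
have -> : Gamma (nu + 1) / (nu * Gamma nu) / e = c * \int[mu]_u gam (nu + 1) u.
  rewrite -Gamma_log_gamma /c; field.
  by rewrite !gt_eqF// Gamma_gt0.
have intg := integrable_log_gamma_kernel nu10.
rewrite -RintegralZl//; apply: le_Rintegral => //.
- apply: integrable_gauss => //; last exact: ltW.
  + by move=> u; rewrite mulr_gt0 ?expR_gt0.
  + by apply: measurable_funM => //; exact: measurable_expRN.
  + exact: integrable_log_gamma_pdf.
- rewrite (_ : _ \o _ = (fun u => c%:E * (gam (nu + 1) u)%:E)%E).
    exact: integrableZl.
  by apply/funext => u.
move=> u _.
have q0 : 0 < nu * expR (- u) * e by rewrite !mulr_gt0 ?expR_gt0.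
apply: le_trans (ler_wpM2l (ltW (log_gamma_pdf_gt0 u nu0)) (expRN_le_inv q0)) _.
rewrite le_eqVlt; apply/orP; left; apply/eqP.
have -> : gam (nu + 1) u = gam nu u * expR u.
  by rewrite /log_gamma_kernel -expRD; congr expR; ring.
rewrite /log_gamma_pdf /c expRN; field.
by rewrite !gt_eqF ?expR_gt0 ?Gamma_gt0.
Qed.

Lemma squared_exponential_gauss_mixture :
  decaying_gauss_mixture (@squared_exponential R) 1.
Proof.
exists (log_gamma_pdf 1), (cst 1); split.
- split=> //; first by move=> u; exact: log_gamma_pdf_gt0.
  exact: integrable_log_gamma_pdf.
- by move=> t _; exact: squared_exponential_mix.
- by rewrite /squared_exponential expr0n/= oppr0 expR0.
exists 1 => // e e0; have -> : e = Num.sqrt e ^+ 2 by rewrite sqr_sqrtr// ltW.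
rewrite -squared_exponential_mix /squared_exponential sqr_sqrtr ?(ltW e0)//.
by rewrite mul1r powRN powRr1 ?(ltW e0)// expRN_le_inv.
Qed.

Lemma rational_quadratic_gauss_mixture nu : 0 < nu ->
  decaying_gauss_mixture (rational_quadratic nu) nu.
Proof.
move=> nu0; exists (log_gamma_pdf nu), (@expR R); split.
- split=> //; first by move=> u; exact: log_gamma_pdf_gt0.
    by move=> u; exact: expR_gt0.
  exact: integrable_log_gamma_pdf.
- by move=> t _; rewrite rational_quadratic_mix// sqr_ge0.
- by rewrite /rational_quadratic expr0n/= addr0 powR1.
exists 1 => // e e0; rewrite rational_quadratic_mix ?(ltW e0)// mul1r !powRN.
rewrite lef_pV2 ?posrE ?powR_gt0 ?addr_gt0//.
by rewrite ge0_ler_powR ?nnegrE ?(ltW nu0) ?addr_ge0 ?(ltW e0)// lerDr.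
Qed.

Lemma matern_gauss_mixture nu : 0 < nu -> decaying_gauss_mixture (matern nu) 1.
Proof.
move=> nu0; exists (log_gamma_pdf nu), (fun u => nu * expR (- u)); split.
- split.
  + by move=> u; exact: log_gamma_pdf_gt0.
  + by move=> u; rewrite mulr_gt0 ?expR_gt0.
  + by apply: measurable_funM => //; exact: measurable_expRN.
  + exact: integrable_log_gamma_pdf.
- by move=> t t0; exact: matern_mix.
- by rewrite /matern eqxx.
exact: matern_decay.
Qed.

End KernelMixtures.

(** * Asymptotics of the reference prior *)

Section Asymptotics.
Variables (R : realType) (r n p : nat).
Variables (x : 'I_n -> 'rV[R]_r) (W : 'M[R]_(n, n - p)).
Implicit Types (K : R -> R).

Lemma prior_ge0 K theta : 0 <= reference_prior K x W theta.
Proof. exact: sqrtr_ge0. Qed.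

Lemma prior_bigO_pinfty K (C : R) :
  (forall theta, 0 < theta -> reference_prior K x W theta <= C / theta) ->
  reference_prior K x W =O_ +oo (fun theta : R => theta^-1).
Proof.
move=> CP; apply/eqO_exP; exists (`|C| + 1); first by rewrite ltr_wpDl.
near=> theta.
have t0 : 0 < theta by near: theta; exact: nbhs_pinfty_gt.
have ti0 : 0 <= theta^-1 by rewrite invr_ge0 ltW.
rewrite (ger0_norm (prior_ge0 _ _)) (ger0_norm ti0).
apply: le_trans (CP _ t0) _; rewrite ler_wpM2r//.
by have := ler_norm C; lra.
Unshelve. all: by end_near. Qed.

Lemma prior_bigO_0 K (D a : R) :
  (\forall theta \near 0^'+, reference_prior K x W theta <= D * theta `^ a) ->
  reference_prior K x W =O_ (0^'+) (fun theta : R => theta `^ a).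
Proof.
move=> DP; apply/eqO_exP; exists (`|D| + 1); first by rewrite ltr_wpDl.
near=> theta.
rewrite (ger0_norm (prior_ge0 _ _)) (ger0_norm (powR_ge0 _ _)).
have h : reference_prior K x W theta <= D * theta `^ a by near: theta.
apply: le_trans h _; rewrite ler_wpM2r ?powR_ge0//.
by have := ler_norm D; lra.
Unshelve. all: by end_near. Qed.

Lemma prior_littleo_0 K (D a : R) : 0 < a ->
  (\forall theta \near 0^'+, reference_prior K x W theta <= D * theta `^ a) ->
  reference_prior K x W =o_ (0^'+) (cst 1 : R -> R).
Proof.
move=> a0 DP; apply/eqoP => _/posnumP[eps].
have small : \forall theta \near 0^'+, D * theta `^ a < eps%:num.
  have : D * theta `^ a @[theta --> 0^'+] --> D * 0.
    by apply: cvgMr; exact: powR_cvg0.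
  by rewrite mulr0 => /cvgr_lt; apply.
near=> theta.
rewrite normr1 mulr1 ger0_norm ?prior_ge0//.
have h : reference_prior K x W theta <= D * theta `^ a by near: theta.
by apply: le_trans h _; apply/ltW; near: theta.
Unshelve. all: by end_near. Qed.

Lemma prior_asymptotics K (k : R) : 0 < k -> decaying_gauss_mixture K k ->
  injective x -> W^T *m W = 1%:M ->
  [/\ reference_prior K x W =O_ +oo (fun theta : R => theta^-1),
      reference_prior K x W =O_ (0^'+) (fun theta : R => theta `^ (2 * k - 1)) &
      1 < 2 * k -> reference_prior K x W =o_ (0^'+) (cst 1 : R -> R)].
Proof.
move=> k0 [phi [a [[phi0 a0 ma iphi] Kmix K0 [B B0 decay]]]] hx hW.
have [C CP] := prior_le_inv phi0 a0 ma iphi Kmix hx hW.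
have [D DP] := prior_le_powR phi0 a0 ma iphi Kmix K0 hx hW k0 B0 decay.
split; [exact: prior_bigO_pinfty CP|exact: prior_bigO_0 DP|move=> k1].
by apply: prior_littleo_0 DP; rewrite subr_gt0.
Qed.

End Asymptotics.

Theorem proposition4p1 (R : realType) (r n p : nat)
  (hr : (1 <= r)%N) (hn : (1 <= n)%N) (hp : (p < n)%N)
  (x : 'I_n -> 'rV[R]_r) (hx : injective x)
  (H : 'M[R]_(n, p)) (hH : \rank H = p)
  (W : 'M[R]_(n, n - p)) (hW : W^T *m W = 1%:M) (hHW : H^T *m W = 0) :
  (* theta -> 0 *)
  [/\ forall nu : R, 1 <= nu ->
        reference_prior (matern nu) x W =o_ (0^'+) (cst 1 : R -> R),
      reference_prior (@squared_exponential R) x W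
        =o_ (0^'+) (cst 1 : R -> R)
    & forall nu : R, 0 < nu ->
        reference_prior (rational_quadratic nu) x W
          =O_ (0^'+) (fun theta : R => theta `^ (2 * nu - 1))]
  /\
  (* theta -> +oo *)
  [/\ forall nu : R, 1 <= nu ->
        reference_prior (matern nu) x W
          =O_ +oo (fun theta : R => theta^-1),
      reference_prior (@squared_exponential R) x W
        =O_ +oo (fun theta : R => theta^-1)
    & forall nu : R, 0 < nu ->
        reference_prior (rational_quadratic nu) x W
          =O_ +oo (fun theta : R => theta^-1)].
Proof.
have pos nu : 1 <= nu -> 0 < nu :> R by exact: lt_le_trans.
have half : 1 < 2 * 1 :> R by lra.
have asym K k k0 (mK : decaying_gauss_mixture K k) :=
  prior_asymptotics k0 mK hx hW.
split; split.
- move=> nu /pos/matern_gauss_mixture/(asym _ _ ltr01)[_ _]; exact.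
- by have [_ _] := asym _ _ ltr01 (squared_exponential_gauss_mixture R); exact.
- move=> nu nu0.
  by have [_] := asym _ _ nu0 (rational_quadratic_gauss_mixture nu0).
- by move=> nu /pos/matern_gauss_mixture/(asym _ _ ltr01)[].
- by have [] := asym _ _ ltr01 (squared_exponential_gauss_mixture R).
- move=> nu nu0.
  by have [] := asym _ _ nu0 (rational_quadratic_gauss_mixture nu0).
Qed.
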